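(* Assume the setting of the context (standing assumptions on $f,h,G$; the stochastic proximal subgradient method; the quantities $L(\cdot)$, $D_h$, $\Lambda(\cdot)$, $\widetilde\Lambda(\cdot,\cdot)$). Let $\epsilon,\delta\in(0,1)$ be arbitrary, let $K\ge 1$ be an integer (the pre-chosen maximum iteration number), and let $$\eta=\min\Big\{\frac{1}{4(L_f+L(\epsilon))},\frac{D_h}{[2K(M_f^2+\Lambda(\epsilon)^2)]^{1/2}}\Big\},\qquad \tilde\eta=\min\Big\{\frac{1}{4(L_f+L(\epsilon))},\frac{D_h}{[2K(M_f^2+\widetilde\Lambda(\delta,\epsilon)^2)]^{1/2}}\Big\}.$$ Then the following hold. (i) Let $\{z^k\}$ be generated by the method with $\eta_k\equiv\eta$ for all $k\ge0$. Then $\mathbb{E}[F(z^K)-F^*]\le\epsilon$ for all $K$ satisfying $$K\ge\max\Big\{\frac{8D_h^2(L_f+L(\epsilon))}{\epsilon},\ \frac{8D_h^2(M_f+\Lambda(\epsilon))^2}{\epsilon^2},\ 1\Big\}.$$ (ii) Suppose additionally that $$\mathbb{E}\big[\exp\{\|G(x;\xi)-\mathbb{E}[G(x;\xi)]\|^\alpha/\sigma^\alpha\}\big]\le\exp\{1\}\qquad\forall x\in\mathrm{dom}\,f.$$ Let $\{z^k\}$ be generated by the method with $\eta_k\equiv\tilde\eta$ for all $k\ge0$. Then, with probability at least $1-\delta$, $F(z^K)-F^*\le\epsilon$ holds for all $K$ satisfying $$K\ge\max\Big\{\frac{8D_h^2(L_f+L(\epsilon))}{\epsilon},\ \frac{32D_h^2(M_f+\widetilde\Lambda(\delta,\epsilon))^2}{\epsilon^2},\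 \Big(\Big(\frac{4\alpha D_h\sigma}{\epsilon}\Big)^{\frac{\alpha}{\alpha-1}}+\mathbb{1}_{(1,2)}(\alpha)\Big)\cdot\frac{\ln(2/\delta)}{\alpha-1},\ 1\Big\}.$$ In both parts the statement is for each fixed $K$ satisfying the stated bound, the step size being the one defined with that $K$.
   Context: Problem. $F^*:=\min_{x\in\mathbb{R}^n}\{F(x):=f(x)+h(x)\}$, where $f,h:\mathbb{R}^n\to(-\infty,\infty]$ are proper lower semicontinuous convex functions with $\mathrm{dom}\,h\subseteq\mathrm{dom}\,f$. $\|\cdot\|$ is the Euclidean norm and $\partial$ denotes the convex subdifferential. Standing assumptions. (a) There are constants $L_f,H_f,M_f\ge0$ and $\nu\in(0,1)$ such that $$\|f'(y)-f'(x)\|\le L_f\|y-x\|+H_f\|y-x\|^\nu+M_f\qquad\forall f'(y)\in\partial f(y),\ f'(x)\in\partial f(x),\ x,y\in\mathrm{dom}\,f.$$ (b) The proximal operator of $h$, $\mathrm{prox}_{\eta h}(x):=\arg\min_{z\in\mathbb{R}^n}\{h(z)+\frac{1}{2\eta}\|z-x\|^2\}$ ($\eta>0$), can be evaluated exactly, and $\mathrm{dom}\,h$ is bounded. (c) The stochastic subgradient estimator $G:\mathbb{R}^n\times\Xi\to\mathbb{R}^n$ satisfies, for some $\sigma>0$ and $\alpha\in(1,2]$, $$\mathbb{E}[G(x;\xi)]\in\partial f(x),\qquad \mathbb{E}[\|G(x;\xi)-\mathbb{E}[G(x;\xi)]\|^\alpha]\le\sigma^\alpha\qquad\forall x\in\mathrm{dom}\,f.$$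 Quantities. $D_h:=\max_{x,y\in\mathrm{dom}\,h}\|x-y\|$ (diameter of $\mathrm{dom}\,h$); since step sizes must be positive, $D_h>0$. For $\varepsilon,\delta>0$, $$L(\varepsilon):=H_f^{\frac{2}{1+\nu}}\Big(\frac{4}{\varepsilon}\Big)^{\frac{1-\nu}{1+\nu}},$$ $$\Lambda(\varepsilon)^2:=8(\alpha-1)^2\Big(\frac{\sigma}{\alpha}\Big)^{\frac{\alpha}{\alpha-1}}\Big(\frac{8D_h}{\varepsilon}\Big)^{\frac{2-\alpha}{\alpha-1}},\qquad \widetilde\Lambda(\delta,\varepsilon)^2:=\Big(1+\ln\Big(\frac{2}{\delta}\Big)\Big)^{\frac{1}{\alpha-1}}\Lambda(\varepsilon)^2,$$ with $\Lambda,\widetilde\Lambda\ge0$. $\mathbb{1}_{(1,2)}(\alpha)$ equals $1$ if $\alpha\in(1,2)$ and $0$ otherwise. Convention: $1/0=+\infty$. Stochastic proximal subgradient method. Input: a (deterministic) starting point $x^0\in\mathrm{dom}\,h$ and step sizes $\{\eta_k\}\subset(0,\infty)$. The samples $\xi_0,\xi_1,\dots$ are i.i.d. copies of $\xi$. For $k=0,1,2,\dots$: $$x^{k+1}=\mathrm{prox}_{\eta_kh}(x^k-\eta_kG(x^k;\xi_k)),\qquad z^{k+1}=\Big(\sum_{t=0}^k\eta_t\Big)^{-1}\sum_{t=0}^k\eta_tx^{t+1}.$$ *)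

(* Defs.v *)
From HB Require Import structures.
From mathcomp Require Import all_boot all_order all_algebra.
From mathcomp Require Import all_classical all_reals all_analysis.

Set Implicit Arguments.
Unset Strict Implicit.
Unset Printing Implicit Defensive.

Import Order.TTheory GRing.Theory Num.Theory.
Import numFieldNormedType.Exports.

Local Open Scope classical_set_scope.
Local Open Scope ring_scope.

Section Euclidean.
Context {R : realType} {n : nat}.
Implicit Types x y : 'rV[R]_n.

Definition dotv x y : R := \sum_(i < n) x 0 i * y 0 i.

(* The library norm `|x| on 'rV[R]_n is the sup norm, hence this one. *)
Definition enorm x : R := Num.sqrt (dotv x x).

Definition ediam (A : set 'rV[R]_n) : R :=
  sup [set d | exists x y, [/\ A x, A y & d = enorm (x - y)]].

End Euclidean.

(* R^n with its Borel sigma-algebra; the topology of 'rV[R]_n is the usual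
   (product) one. *)
Definition borelRn (R : realType) (n : nat) :=
  g_sigma_algebraType (@open 'rV[R]_n).

Section Convex.
Context {R : realType} {n : nat}.
Implicit Types (f h : 'rV[R]_n -> \bar R) (x y : 'rV[R]_n).

Definition edom f : set 'rV[R]_n := [set x | (f x < +oo)%E].

Definition eproper f :=
  (forall x, (-oo < f x)%E) /\ (exists x, edom f x).

(* Only meaningful when f avoids -oo (properness); at the endpoints t = 0, 1
   the convention 0 * +oo = 0 makes the inequality trivial. *)
Definition econvex f := forall x y (t : R), 0 <= t <= 1 ->
  (f (t *: x + (1 - t) *: y)%R <= t%:E * f x + (1 - t)%:E * f y)%E.

Definition proper_lsc_convex f :=
  [/\ eproper f, lower_semicontinuous f & econvex f].

Definition subdifferential f x : set 'rV[R]_n :=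
  [set g | edom f x /\ forall y, (f x + (dotv g (y - x))%:E <= f y)%E].

Definition argmin (phi : 'rV[R]_n -> \bar R) : set 'rV[R]_n :=
  [set z | forall w, (phi z <= phi w)%E].

(* For h proper, lower semicontinuous and convex and eta > 0 the argmin is a
   singleton, so that the choice made by [get] is irrelevant. *)
Definition prox (eta : R) h x : 'rV[R]_n :=
  get (argmin (fun z => h z + ((2 * eta)^-1 * enorm (z - x) ^+ 2)%:E)%E).

Definition holder_like_subgradients f (Lf Hf Mf nu : R) :=
  forall x y gx gy, edom f x -> edom f y ->
    subdifferential f x gx -> subdifferential f y gy ->
    enorm (gy - gx) <=
      Lf * enorm (y - x) + Hf * (enorm (y - x) `^ nu) + Mf.

End Convex.

Section Oracle.
Context {R : realType} {n : nat} {d : measure_display} {Xi : measurableType d}.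
Variables (mu : probability Xi R) (G : 'rV[R]_n -> Xi -> 'rV[R]_n).

Definition mean (g : Xi -> 'rV[R]_n) : 'rV[R]_n :=
  \row_(i < n) fine 'E_mu[fun s => g s 0 i].

(* Joint measurability of (x, s) |-> G x s. *)
Definition measurable_estimator :=
  measurable_fun [set: borelRn R n * Xi]
    (fun p : borelRn R n * Xi => G p.1 p.2 : borelRn R n).

Definition unbiased_subgradient (f : 'rV[R]_n -> \bar R) :=
  forall x, edom f x ->
    (forall i, mu.-integrable [set: Xi] (fun s => (G x s 0 i)%:E)) /\
    subdifferential f x (mean (G x)).

Definition noise (x : 'rV[R]_n) (s : Xi) : R := enorm (G x s - mean (G x)).

Definition bounded_noise_moment (f : 'rV[R]_n -> \bar R) (sigma alpha : R) :=
  forall x, edom f x ->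
    ('E_mu[fun s => (noise x s `^ alpha)%R] <= (sigma `^ alpha)%:E)%E.

Definition light_tailed_noise (f : 'rV[R]_n -> \bar R) (sigma alpha : R) :=
  forall x, edom f x ->
    ('E_mu[fun s => expR (noise x s `^ alpha / sigma `^ alpha)%R]
       <= (expR 1)%:E)%E.

End Oracle.

Section Sampling.
Context {R : realType} {d d' : measure_display}.
Context {Xi : measurableType d} {Omega : measurableType d'}.

Definition mutually_independent (P : probability Omega R)
    (xi : nat -> Omega -> Xi) :=
  forall (J : seq nat) (A : nat -> set Xi), uniq J ->
    (forall k, measurable (A k)) ->
    P (\bigcap_(k in [set` J]) (xi k @^-1` A k)) =
      (\prod_(k <- J) P (xi k @^-1` A k))%E.

Definition iid_samples (P : probability Omega R) (mu : probability Xi R)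
    (xi : nat -> Omega -> Xi) :=
  [/\ forall k, measurable_fun [set: Omega] (xi k),
      forall k (A : set Xi), measurable A -> P (xi k @^-1` A) = mu A
    & mutually_independent P xi].

End Sampling.

Section Method.
Context {R : realType} {n : nat} {Xi : Type}.
Variables (h : 'rV[R]_n -> \bar R) (G : 'rV[R]_n -> Xi -> 'rV[R]_n).
Variables (x0 : 'rV[R]_n) (eta : nat -> R).

Fixpoint spsg_iter (s : nat -> Xi) (k : nat) : 'rV[R]_n :=
  if k is k'.+1 then
    let x := spsg_iter s k' in prox (eta k') h (x - eta k' *: G x (s k'))
  else x0.

(* The averaged iterate z^k, meaningful for k >= 1. *)
Definition spsg_avg (s : nat -> Xi) (k : nat) : 'rV[R]_n :=
  (\sum_(t < k) eta t)^-1 *: \sum_(t < k) eta t *: spsg_iter s t.+1.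

End Method.

Section Quantities.
Context {R : realType}.

Definition Leps (Hf nu eps : R) : R :=
  Hf `^ (2 / (1 + nu)) * (4 / eps) `^ ((1 - nu) / (1 + nu)).

Definition Lambda_sq (Dh sigma alpha eps : R) : R :=
  8 * (alpha - 1) ^+ 2 * (sigma / alpha) `^ (alpha / (alpha - 1)) *
    (8 * Dh / eps) `^ ((2 - alpha) / (alpha - 1)).

Definition Lambda (Dh sigma alpha eps : R) : R :=
  Num.sqrt (Lambda_sq Dh sigma alpha eps).

Definition tLambda_sq (Dh sigma alpha delta eps : R) : R :=
  (1 + ln (2 / delta)) `^ (alpha - 1)^-1 * Lambda_sq Dh sigma alpha eps.

Definition tLambda (Dh sigma alpha delta eps : R) : R :=
  Num.sqrt (tLambda_sq Dh sigma alpha delta eps).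

(* The quotients are taken in \bar R, where 1 / 0 = +oo, because
   Lf + Leps = 0 is allowed; the minimum is finite as soon as Lam <> 0. *)
Definition stepsize (Lf Mf Dh Le Lam : R) (K : nat) : R :=
  fine (mine (1 / (4 * (Lf + Le))%:E)
             (Dh%:E / (Num.sqrt (2 * K%:R * (Mf ^+ 2 + Lam ^+ 2)))%:E))%E.

End Quantities.

(* Main.v *)
From HB Require Import structures.
Require Import Defs.
From mathcomp Require Import all_boot all_order all_algebra.
From mathcomp Require Import finmap.
From mathcomp Require Import all_classical all_reals all_analysis.
From mathcomp Require Import measurable_realfun ring lra.

(** The three-point inequality for the proximal step and the Hoelder-like bound on the
    subgradients give a one-step descent inequality whose error has three parts: the
    Hoelder residual, at most [eps / 8] by Young's inequality (this is where [L(eps)] comes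
    from); the inner product of the noise with the direction of a minimiser; and the
    product of the noise norm [s] with the displacement [d] of the iterate. The last is
    absorbed by [d ^ 2 / 8] plus a multiple of [(s / sigma) ^ alpha], using [d <= D]; a
    weighted AM-GM inequality turns that multiple into [eta ^ 2 Lambda(eps) ^ 2] up to
    [eta eps / 8]. Summing telescopes, and convexity passes to the average.

    In expectation the inner products vanish, since the iterate is independent of the next
    sample. For the tail bound, [exp (sum of ((s / sigma) ^ alpha - 1))] has mean at most [1],
    and the normalised inner products [y] satisfy [E exp (l y) <= exp (l ^ alpha)] for
    [l <= 1], because [exp u <= u + exp (|u| ^ alpha)]; Markov's inequality applied to the two
    exponentials costs [delta / 2] each. *)

Set Implicit Arguments.
Unset Strict Implicit.
Unset Printing Implicit Defensive.

Import Order.TTheory GRing.Theory Num.Theory.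
Import numFieldNormedType.Exports.

Local Open Scope classical_set_scope.
Local Open Scope ring_scope.

(** * Euclidean space, convex functions and the proximal map *)

Section EuclideanSpace.
Context {R : realType} {n : nat}.
Implicit Types x y z : 'rV[R]_n.

Lemma dotvC x y : dotv x y = dotv y x.
Proof. by apply: eq_bigr => i _; rewrite mulrC. Qed.

Lemma dotvDl x y z : dotv (x + y) z = dotv x z + dotv y z.
Proof. by rewrite -big_split; apply: eq_bigr => i _; rewrite mxE mulrDl. Qed.

Lemma dotvZl a x y : dotv (a *: x) y = a * dotv x y.
Proof. by rewrite mulr_sumr; apply: eq_bigr => i _; rewrite mxE mulrA. Qed.

Lemma dotvNl x y : dotv (- x) y = - dotv x y.
Proof. by rewrite -scaleN1r dotvZl mulN1r. Qed.

Lemma dotvDr x y z : dotv z (x + y) = dotv z x + dotv z y.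
Proof. by rewrite !(dotvC z) dotvDl. Qed.

Lemma dotvZr a x y : dotv x (a *: y) = a * dotv x y.
Proof. by rewrite !(dotvC x) dotvZl. Qed.

Lemma dotvNr x y : dotv x (- y) = - dotv x y.
Proof. by rewrite !(dotvC x) dotvNl. Qed.

Definition dotvE := (dotvDl, dotvDr, dotvNl, dotvNr, dotvZl, dotvZr).

Lemma dotv_ge0 x : 0 <= dotv x x.
Proof. by apply: sumr_ge0 => i _; rewrite -expr2 sqr_ge0. Qed.

Lemma enorm_ge0 x : 0 <= enorm x. Proof. exact: sqrtr_ge0. Qed.

Lemma sqr_enorm x : enorm x ^+ 2 = dotv x x.
Proof. by rewrite sqr_sqrtr// dotv_ge0. Qed.

Lemma enormN x : enorm (- x) = enorm x.
Proof. by rewrite /enorm !dotvE opprK. Qed.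

Lemma enormB x y : enorm (x - y) = enorm (y - x).
Proof. by rewrite -enormN opprB. Qed.

Lemma coord_le_enorm x i : `|x 0 i| <= enorm x.
Proof.
rewrite -ler_sqr ?nnegrE ?enorm_ge0// sqr_enorm real_normK ?num_real//.
rewrite /dotv (bigD1 i)//= -expr2 lerDl; apply: sumr_ge0 => j _.
by rewrite -expr2 sqr_ge0.
Qed.

Lemma enorm0_eq0 x : enorm x = 0 -> x = 0.
Proof.
move=> x0; apply/rowP => i; rewrite mxE; apply/eqP.
by rewrite -normr_le0 (le_trans (coord_le_enorm _ _))// x0.
Qed.

(** Cauchy-Schwarz, by expanding the square of [enorm y *: x - enorm x *: y]. The product of the two
    norms is cancelled at the end, so vanishing norms are treated first. *)
Lemma dotv_le_enorm x y : dotv x y <= enorm x * enorm y.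
Proof.
have [y0|y0] := eqVneq (enorm y) 0.
  by rewrite y0 (enorm0_eq0 y0) mulr0 /dotv big1// => i _; rewrite mxE mulr0.
have y_gt0 : 0 < enorm y by rewrite lt_neqAle eq_sym y0 enorm_ge0.
have [x0|x0] := eqVneq (enorm x) 0.
  by rewrite x0 (enorm0_eq0 x0) mul0r /dotv big1// => i _; rewrite mxE mul0r.
have x_gt0 : 0 < enorm x by rewrite lt_neqAle eq_sym x0 enorm_ge0.
have := dotv_ge0 (enorm y *: x - enorm x *: y).
rewrite !dotvE -!sqr_enorm (dotvC y x).
set a := enorm x in x_gt0 *; set b := enorm y in y_gt0 *; set c := dotv x y.
move=> H; have : 0 <= 2 * (a * b) * (a * b - c) by nra.
by rewrite pmulr_rge0 ?subr_ge0// !mulr_gt0.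
Qed.

Lemma norm_dotv_le x y : `|dotv x y| <= enorm x * enorm y.
Proof.
rewrite ler_norml dotv_le_enorm andbT lerNl -dotvNl.
by rewrite (le_trans (dotv_le_enorm _ _))// enormN.
Qed.

Lemma sqr_enormD x y : enorm (x + y) ^+ 2 = enorm x ^+ 2 + 2 * dotv x y + enorm y ^+ 2.
Proof. by rewrite !sqr_enorm !dotvDl !dotvDr (dotvC y x); ring. Qed.

(** The parallelogram law with the square of [enorm (x + y)] dropped. *)
Lemma enormB_le2 x y : enorm (x - y) ^+ 2 <= 2 * enorm x ^+ 2 + 2 * enorm y ^+ 2.
Proof.
rewrite !sqr_enorm; have := dotv_ge0 (x + y).
by rewrite !dotvE (dotvC y x); lra.
Qed.

(** The bound [B] makes the set of distances bounded above, so that its [sup] is a genuine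
    supremum. *)
Lemma le_ediam (A : set 'rV[R]_n) (B : R) x y :
  (forall z, A z -> enorm z <= B) -> A x -> A y -> enorm (x - y) <= ediam A.
Proof.
move=> AB Ax Ay; apply: ub_le_sup; last by exists x, y.
exists (2 * B) => _ [u [v [Au Av ->]]].
have B0 : 0 <= B by apply: le_trans (AB _ Ax); exact: enorm_ge0.
rewrite -ler_sqr ?nnegrE ?enorm_ge0//; last by lra.
rewrite (le_trans (enormB_le2 _ _))//.
have := AB _ Au; have := AB _ Av.
by have := enorm_ge0 u; have := enorm_ge0 v; nra.
Qed.

Lemma sum_continuous (F : 'I_n -> 'rV[R]_n -> R) :
  (forall i, continuous (F i)) -> continuous (fun x => \sum_(i < n) F i x).
Proof.
move=> cF; apply: (@continuous_big R _ +%R 0 predT) => [|i _]; last exact: cF.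
exact: (@add_continuous R).
Qed.

Lemma enorm_continuous : continuous (@enorm R n).
Proof.
move=> y; apply: continuous_comp; last exact: sqrt_continuous.
move: y; refine (@sum_continuous (fun i y => y 0 i * y 0 i) _) => i y.
by apply: continuousM; exact: coord_continuous.
Qed.

Lemma sqr_enormB_continuous v : continuous (fun x : 'rV[R]_n => enorm (x - v) ^+ 2).
Proof.
move=> x; pose s (y : 'rV[R]_n) := y - v.
apply: (@continuous_comp _ _ _ (@enorm R n \o s) (fun r => r ^+ 2)); last first.
  exact: exprn_continuous.
apply: continuous_comp; last exact: enorm_continuous.
apply: (@continuousB _ _ _ id (cst v)); last exact: cst_continuous.
exact: cvg_id.
Qed.

End EuclideanSpace.

(** * Convex averages, lower semicontinuity and existence of minimisers *)

Section ConvexAnalysis.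
Context {R : realType} {n : nat}.
Implicit Types (f g h : 'rV[R]_n -> \bar R) (x y z : 'rV[R]_n).

Lemma fineK_edom f x : (-oo < f x)%E -> edom f x -> (fine (f x))%:E = f x.
Proof. by move=> fx fxy; rewrite fineK// fin_numElt fx. Qed.

Lemma econvex_edom f x y (t : R) : eproper f -> econvex f -> 0 <= t <= 1 ->
  edom f x -> edom f y -> edom f (t *: x + (1 - t) *: y).
Proof.
move=> [f0 _] cf t01 fx fy; rewrite /edom/=; apply: le_lt_trans (cf _ _ _ t01) _.
by rewrite -(fineK_edom (f0 x) fx) -(fineK_edom (f0 y) fy) -!EFinM -EFinD ltry.
Qed.

Lemma econvex_fine f x y (t : R) : eproper f -> econvex f -> 0 <= t <= 1 ->
  edom f x -> edom f y ->
  fine (f (t *: x + (1 - t) *: y)) <= t * fine (f x) + (1 - t) * fine (f y).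
Proof.
move=> pf cf t01 fx fy; have fxy := econvex_edom pf cf t01 fx fy.
case: pf => f0 _; rewrite -lee_fin fineK_edom// EFinD !EFinM.
by rewrite !fineK_edom//; exact: cf.
Qed.

(** Jensen's inequality with equal weights, by induction: the new average is the convex combination
    of the new point, with weight [k.+2%:R^-1], and the old average. *)
Lemma econvex_average f (x : nat -> 'rV[R]_n) k : eproper f -> econvex f ->
  (forall t, edom f (x t)) ->
  edom f (k.+1%:R^-1 *: \sum_(t < k.+1) x t) /\
  k.+1%:R * fine (f (k.+1%:R^-1 *: \sum_(t < k.+1) x t)) <= \sum_(t < k.+1) fine (f (x t)).
Proof.
move=> pf cf fx; elim: k => [|k [IH1 IH2]].
  by rewrite !big_ord_recl !big_ord0 !addr0 invr1 scale1r mul1r; split.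
pose t : R := k.+2%:R^-1; pose y := k.+1%:R^-1 *: \sum_(t < k.+1) x t.
have k0 : 0 < k.+1%:R :> R by rewrite ltr0n.
have kE : k.+2%:R = k.+1%:R + 1 :> R by rewrite -natr1.
have t01 : 0 <= t <= 1 by rewrite /t kE invr_ge0 invf_le1; lra.
have t1 : 1 - t = t * k.+1%:R by rewrite /t kE; field; rewrite gt_eqF//; lra.
have yE : k.+2%:R^-1 *: \sum_(t < k.+2) x t = t *: x k.+1 + (1 - t) *: y.
  rewrite big_ord_recr /= scalerDr addrC t1 scalerA -mulrA divff ?mulr1// gt_eqF//.
rewrite yE; split; first exact: econvex_edom.
rewrite big_ord_recr /=; have := econvex_fine pf cf t01 (fx k.+1) IH1.
rewrite -/y in IH2 *; rewrite -(@ler_pM2l _ k.+2%:R) ?ltr0n// => /le_trans; apply.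
have kt : k.+2%:R * t = 1 by rewrite /t divff// gt_eqF// ltr0n.
set a := fine (f (x _)); set b := fine (f y) in IH2 *.
have -> : k.+2%:R * (t * a + (1 - t) * b) = k.+2%:R * t * (a + k.+1%:R * b).
  by rewrite t1; ring.
by rewrite kt mul1r [X in _ <= X]addrC lerD2l.
Qed.

Lemma lower_semicontinuousD f g : (forall x, -oo < f x)%E ->
  (forall x, -oo < g x)%E -> lower_semicontinuous f -> lower_semicontinuous g ->
  lower_semicontinuous (fun x => f x + g x)%E.
Proof.
move=> f0 g0 lf lg x a afg.
(* The threshold [a] is split between the summands. If both values are finite, each gives up half of
   the gap; an infinite value leaves room for any threshold. *)
have [b [c [bf cg abc]]] : exists b c : R,
    [/\ (b%:E < f x)%E, (c%:E < g x)%E & a <= b + c].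
  move: afg; have := f0 x; have := g0 x.
  case: (f x) (g x) => [u||] [v||]// _ _ h.
  - exists (u - (u + v - a) / 2), (v - (u + v - a) / 2).
    by move: h; rewrite !lte_fin => h; split; lra.
  - by exists (u - 1), (a - u + 1); rewrite lte_fin ltry; split=> //; lra.
  - by exists (a - v + 1), (v - 1); rewrite lte_fin ltry; split=> //; lra.
  - by exists a, 0; rewrite !ltry; split=> //; lra.
have [V xV Vf] := lf _ _ bf; have [W xW Wg] := lg _ _ cg.
exists (V `&` W); first exact: filterI.
move=> y [Vy Wy]; apply: (@le_lt_trans _ _ (b%:E + c%:E)%E); first by rewrite lee_fin.
by apply: lteD; [exact: Vf|exact: Wg].
Qed.

Lemma lower_semicontinuous_EFin (g : 'rV[R]_n -> R) : continuous g ->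
  lower_semicontinuous (fun x => (g x)%:E).
Proof.
move=> cg; apply/lower_semicontinuousP => a.
rewrite (_ : mkset _ = g @^-1` [set r | a < r]).
  by apply: open_comp => //; exact: open_gt.
by apply/seteqP; split => x /=; rewrite lte_fin.
Qed.

(** Weierstrass by covers: if the infimum [m] were not attained, the open sets where [f] exceeds
    some [a > m] would cover a compact ball containing the domain. The least threshold [a0] of a
    finite subcover would then be a lower bound of [f] above [m]. *)
Lemma ex_argmin f : (forall x, -oo < f x)%E -> lower_semicontinuous f ->
  edom f !=set0 -> (exists B : R, forall x, edom f x -> enorm x <= B) ->
  exists z, argmin f z.
Proof.
move=> f0 lf [x0 fx0] [B fB].
pose m := ereal_inf (range f).
have [[z mz]|noz] := pselect (exists z, (f z <= m)%E).
  by exists z => w; apply: le_trans mz _; apply: ereal_inf_lbound; exists w.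
have mf x : (m < f x)%E by rewrite ltNge; apply/negP => ?; apply: noz; exists x.
pose A := [set x : 'rV[R]_n | enorm x <= B].
have : cover_compact A.
  rewrite -compact_cover; apply: bounded_closed_compact.
    exists B; split => [|M BM x /= xB]; first exact: num_real.
    rewrite [leLHS]/Num.Def.normr/= mx_normrE; apply/bigmax_leP.
    have B0 : 0 <= B by apply: le_trans xB; exact: enorm_ge0.
    split => [|[i j] _]; first lra.
    rewrite ord1 (le_trans (coord_le_enorm _ _))//; exact: le_trans (ltW BM).
  rewrite (_ : A = enorm @^-1` [set r | r <= B])//.
  by apply: closed_comp (@closed_le _ B) => x _; exact: enorm_continuous.
move=> /(_ R [set a | m < a%:E]%E (fun a => [set x | a%:E < f x]%E)).
case=> [a _|x Ax|D Dm DA].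
- by move/lower_semicontinuousP : lf; exact.
- have : exists a : R, (m < a%:E /\ a%:E < f x)%E.
    move: m mf {noz} => m /(_ x); have := f0 x; case: (f x) => [r| |//] _.
      case: m => [s|//|]; first by rewrite lte_fin => sr; exists ((r+s)/2); rewrite !lte_fin; lra.
      by move=> _; exists (r - 1); rewrite ltNyr lte_fin; split => //; lra.
    case: m => [s _|//|]; first by exists (s + 1); rewrite lte_fin ltry; split => //; lra.
    by move=> _; exists 0; rewrite ltNyr ltry.
  by case=> a [ma af]; exists a.
have [a0 ma0 a0D] : exists2 a0 : R, (m < a0%:E)%E & forall a, a \in D -> a0 <= a.
  have {}Dm a : a \in D -> (m < a%:E)%E by move/Dm; rewrite inE.
  have low (s : seq R) : (forall a, a \in s -> (m < a%:E)%E) ->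
      exists2 a0 : R, (m < a0%:E)%E & forall a, a \in s -> a0 <= a; last exact: low Dm.
  (* An empty list of thresholds still needs some number above [m]; the value at a point of the
     domain is one, since [m] is not attained. *)
  elim: s => [|a s IHs] ms; first by exists (fine (f x0)); rewrite ?fineK_edom.
  have [|a0 ma0 a0s] := IHs; first by move=> b bs; apply: ms; rewrite inE bs orbT.
  exists (Num.min a a0) => [|b].
    by rewrite EFin_min lt_min ma0 andbT ms// mem_head.
  by rewrite inE => /predU1P[->|/a0s]; rewrite ge_min ?lexx// => ->; rewrite orbT.
have : (a0%:E <= m)%E.
  apply: le_ereal_inf_tmp => _ [x _ <-].
  have [fx|] := ltP (f x) +oo%E; last by rewrite leye_eq => /eqP ->; rewrite leey.
  have [a aD /= afx] := DA _ (fB _ fx).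
  by rewrite (le_trans _ (ltW afx))// lee_fin a0D.
by rewrite leNgt ma0.
Qed.

End ConvexAnalysis.

(** * The proximal map *)

Section Proximal.
Context {R : realType} {n : nat}.
Variables (h : 'rV[R]_n -> \bar R) (eta : R).
Hypotheses (hh : proper_lsc_convex h)
  (hbnd : exists B : R, forall x, edom h x -> enorm x <= B) (eta0 : 0 < eta).
Implicit Types v x z : 'rV[R]_n.

Local Notation c := ((2 * eta)^-1).

(** [get] returns a minimiser as soon as one exists, and the bounded domain of [h] makes the
    Weierstrass argument applicable to the proximal objective. *)
Lemma prox_argmin v :
  argmin (fun z => h z + (c * enorm (z - v) ^+ 2)%:E)%E (prox eta h v).
Proof.
case: hh => -[h0 [x0 hx0]] lh _.
have phi0 z : (-oo < h z + (c * enorm (z - v) ^+ 2)%:E)%E.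
  by have := h0 z; case: (h z) => [r _|_|//]; rewrite ?addye// -EFinD ltNyr.
have [||||z zmin] := @ex_argmin _ _ (fun z => h z + (c * enorm (z - v) ^+ 2)%:E)%E.
- by [].
- apply: lower_semicontinuousD => [//|z|//|]; first by rewrite ltNyr.
  apply: lower_semicontinuous_EFin => z.
  exact: cvgMl_tmp (@sqr_enormB_continuous _ _ v z).
- exists x0; move: hx0; rewrite /edom /=; have := h0 x0.
  by case: (h x0) => //= r _ _; rewrite ltry.
- have [B hB] := hbnd; exists B => x hx; apply: hB.
  by move: hx; rewrite /edom /=; case: (h x) => [r _||_]; rewrite ?ltry ?addye ?ltNyy.
by apply: getPex; exists z.
Qed.

Lemma prox_edom v : edom h (prox eta h v).
Proof.
case: hh => -[h0 [x0 hx0]] _ _.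
have /= := prox_argmin v x0; rewrite -(fineK_edom (h0 x0) hx0) -EFinD => pv.
have := le_lt_trans pv (ltry _); rewrite /edom /=.
by case: (h _) => [r _||_]; rewrite ?ltry ?addye ?ltNyy.
Qed.

(* The objective of the proximal step is strongly convex: test its minimality
   on the segment from the minimiser to [z] and let the point tend to the minimiser. *)
Lemma prox_three_points v z (p := prox eta h v) : edom h z ->
  fine (h p) + c * enorm (p - v) ^+ 2 + c * enorm (z - p) ^+ 2
    <= fine (h z) + c * enorm (z - v) ^+ 2.
Proof.
move=> hz; have hp : edom h p := prox_edom v.
case: (hh) => ph _ ch; have h0 := ph.1.
have c0 : 0 < c by rewrite invr_gt0 mulr_gt0.
pose A := fine (h p) + c * enorm (p - v) ^+ 2.
pose B := fine (h z) + c * enorm (z - v) ^+ 2.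
pose Q := c * enorm (z - p) ^+ 2; rewrite -/A -/B -/Q.
have Q0 : 0 <= Q by rewrite mulr_ge0// ?sqr_ge0// ltW.
have key (t : R) : 0 < t <= 1 -> A + (1 - t) * Q <= B.
  move=> /andP[t0 t1]; have t01 : 0 <= t <= 1 by rewrite t1 ltW.
  have hw := econvex_edom ph ch t01 hz hp.
  have Wh := econvex_fine ph ch t01 hz hp.
  have := prox_argmin v (t *: z + (1 - t) *: p); rewrite -/p.
  rewrite -(fineK_edom (h0 _) hp) -(fineK_edom (h0 _) hw) -!EFinD lee_fin.
  (* The squared norm on a segment, with its exact strong-convexity defect
     [t * (1 - t) * enorm (z - p) ^+ 2]. *)
  have -> : enorm (t *: z + (1 - t) *: p - v) ^+ 2 =
     t * enorm (z - v) ^+ 2 + (1 - t) * enorm (p - v) ^+ 2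
       - t * (1 - t) * enorm (z - p) ^+ 2.
    by rewrite !sqr_enorm !dotvE !(dotvC v) !(dotvC p z); ring.
  by move=> AW; rewrite -(ler_pM2l t0) /A /B /Q; lra.
(* In place of a limit: if the inequality failed by [g > 0], then [key] at [t = g / (Q + g)] would
   give [g <= t * Q = g - t * g]. *)
rewrite leNgt; apply/negP => BA; pose g := A + Q - B.
have g0 : 0 < g by rewrite /g; lra.
have Qg : 0 < Q + g by lra.
have t0 : 0 < g / (Q + g) by rewrite divr_gt0.
have t1 : g / (Q + g) <= 1 by rewrite ler_pdivrMr//; lra.
have tE : g / (Q + g) * (Q + g) = g by rewrite divfK// gt_eqF.
have := key (g / (Q + g)); rewrite t0 t1 => /(_ isT) AB.
have := mulr_gt0 t0 g0; move: tE AB; rewrite /g; set t := _ / _; lra.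
Qed.

End Proximal.

(** * Inequalities for the parameters *)

Section RealInequalities.
Context {R : realType}.
Implicit Types a b c d x y : R.

Lemma powR_div a b (p : R) : 0 <= a -> 0 < b -> (a / b) `^ p = a `^ p / b `^ p.
Proof.
move=> a0 b0; have bp0 : b `^ p != 0 by rewrite gt_eqF// powR_gt0.
have := @powRM R (a / b) b p; rewrite divfK ?gt_eqF// => ->//.
- by rewrite mulfK.
- by rewrite divr_ge0// ltW.
- exact: ltW.
Qed.

(** Young's inequality for the conjugate exponents [t^-1] and [(1 - t)^-1]; the endpoints, where one
    of them is not defined, are checked by hand. *)
Lemma powR_weighted_am_gm x y (t : R) : 0 <= x -> 0 <= y -> 0 <= t <= 1 ->
  x `^ t * y `^ (1 - t) <= t * x + (1 - t) * y.
Proof.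
move=> x0 y0 /andP[]; rewrite le_eqVlt => /predU1P[<- _|t0].
  by rewrite powRr0 subr0 powRr1// mul0r add0r !mul1r.
rewrite le_eqVlt => /predU1P[->|t1].
  by rewrite subrr powRr0 powRr1// mul0r addr0 mul1r mulr1.
have := @conjugate_powR R (x `^ t) (y `^ (1 - t)) t^-1 (1 - t)^-1.
rewrite !powR_ge0 !invr_gt0 subr_gt0 t0 t1 !invrK subrKC.
move=> /(_ isT isT isT isT erefl) /le_trans; apply.
rewrite -!powRrM !divff ?gt_eqF ?subr_gt0// !powRr1//.
by rewrite lerD// mulrC.
Qed.

(** For [x >= 0], bound the factor [expR (x ^+ 2 - x)] below by [1 + x ^+ 2 - x] and use
    [expR x * (1 - x) <= 1]. For [x < 0], the same bound on [expR x] suffices because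
    [(1 + x + x ^+ 2) * (1 - x) = 1 - x ^+ 3] is at least [1]. *)
Lemma expR_le_add_expR_sqr x : expR x <= x + expR (x ^+ 2).
Proof.
have [x0|x0] := leP 0 x.
  have -> : expR (x ^+ 2) = expR x * expR (x ^+ 2 - x) by rewrite -expRD subrKC.
  have h1 := expR_ge1Dx (x ^+ 2 - x).
  have : expR x * (1 - x) <= 1.
    rewrite -(@ler_pM2r _ (expR (- x))) ?expR_gt0// mulrAC -expRD subrr expR0 !mul1r.
    exact: expR_ge1Dx.
  have := expR_gt0 x; nra.
have h1 := expR_ge1Dx (x ^+ 2); have h2 := expR_ge1Dx (- x).
have : expR x * expR (- x) = 1 by rewrite -expRD subrr expR0.
have := expR_gt0 x; set e := expR x; set f := expR (- x) in h2 *.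
move=> e0 ef; have : e * (1 - x) <= 1 by nra.
move=> h3; have : e * (1 - x) <= (1 + x + x ^+ 2) * (1 - x) by nra.
by rewrite ler_pM2r; lra.
Qed.

(** For [|x| <= 1] the square is at most the power [alpha]. For larger [|x|] the power exceeds
    [|x|], and [expR |x|] alone beats the left side, even after adding a negative [x]. *)
Lemma expR_le_add_expR_powR (alpha : R) x : 1 <= alpha <= 2 ->
  expR x <= x + expR (`|x| `^ alpha).
Proof.
move=> /andP[a1 a2]; have [x1|x1] := leP `|x| 1.
  apply: le_trans (expR_le_add_expR_sqr x) _; rewrite lerD2l ler_expR.
  have [->|x0] := eqVneq x 0; first by rewrite expr0n /= powR_ge0.
  rewrite -[x ^+ 2]real_normK ?num_real// -powR_mulrn//.
  by apply: ger_powR => //; rewrite normr_gt0 x0.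
have : expR `|x| <= expR (`|x| `^ alpha) by rewrite ler_expR le1r_powR// ltW.
have := expR_ge1Dx `|x|; move: x1.
have [x0|x0] := ger0P x => x1; first by have := expR_gt0 x; lra.
have : expR x <= 1 by rewrite -[X in _ <= X]expR0 ler_expR ltW.
lra.
Qed.

(** Weighted AM-GM between [expR x] and [1]. *)
Lemma expR_scale_le x (t : R) : 0 <= t <= 1 -> expR (t * x) <= t * expR x + (1 - t).
Proof.
move=> t01; have := powR_weighted_am_gm (ltW (expR_gt0 x)) ler01 t01.
by rewrite powR1 !mulr1 /powR gt_eqF ?expR_gt0// expRK.
Qed.

Lemma powR_eq_ln x y : 0 < x -> 0 < y -> ln x = ln y -> x = y.
Proof. by move=> x0 y0; apply: ln_inj; rewrite posrE. Qed.

End RealInequalities.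

Ltac pos := repeat first [assumption | apply: mulr_gt0 | apply: powR_gt0
  | rewrite invr_gt0 | apply: exprn_gt0 | rewrite posrE | exact: ltr0Sn | lra].

(** Taking logarithms turns an identity between products of real powers into one that is linear in
    the logarithms, with rational functions of the exponents as coefficients; [field] can then close
    it. *)
Ltac by_ln := apply: powR_eq_ln; [by pos | by pos |
  rewrite !(lnM, ln_powR, lnV, lnXn); try (by pos)].

(** * Error terms of one step *)

Section ErrorTerms.
Context {R : realType}.

(* [Leps] is the constant for which the weighted AM-GM inequality with weight
   [(1 + nu) / 2] yields exactly this bound. *)
Lemma holder_term_le (Hf nu eps d : R) : 0 <= Hf -> 0 < nu < 1 -> 0 < eps -> 0 <= d ->
  Hf * d `^ nu * d <= Leps Hf nu eps * d ^+ 2 + eps / 8.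
Proof.
move=> H0 /andP[nu0 nu1] e0; rewrite le_eqVlt => /predU1P[<-|d0].
  by rewrite mulr0 expr0n mulr0 add0r divr_ge0// ltW.
move: H0; rewrite le_eqVlt => /predU1P[<-|H0].
  by rewrite !mul0r addr_ge0 ?divr_ge0 ?mulr_ge0 ?powR_ge0 ?sqr_ge0// ltW.
have e40 : 0 < eps / 4 by rewrite divr_gt0.
have L0 : 0 < Leps Hf nu eps by rewrite mulr_gt0 ?powR_gt0 ?divr_gt0.
have t01 : 0 <= (1 + nu) / 2 <= 1 by lra.
have := powR_weighted_am_gm (ltW (mulr_gt0 L0 (exprn_gt0 2 d0))) (ltW e40) t01.
have -> : (Leps Hf nu eps * d ^+ 2) `^ ((1 + nu) / 2) * (eps / 4) `^ (1 - (1 + nu) / 2)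
    = Hf * d `^ nu * d.
  rewrite /Leps; by_ln.
  by field; rewrite gt_eqF//; lra.
(* The second weight [1 - (1 + nu) / 2] is at most one half, which turns [eps / 4] into
   [eps / 8]. *)
move=> /le_trans; apply; apply: lerD; last first.
  by rewrite mulrC; nra.
by rewrite ler_piMl//; [rewrite ltW// mulr_gt0// exprn_gt0|lra].
Qed.

(* The best [B] with [eta s d <= d ^ 2 / 8 + B (s / sigma) ^ alpha] for all [0 <= d <= D]. *)
Definition noise_coef (D sigma alpha eta : R) : R :=
  (8 * (alpha - 1)) `^ (alpha - 1) * (sigma / alpha) `^ alpha *
    D `^ (2 - alpha) * eta `^ alpha.

Context (D sigma alpha eta eps : R).
Hypotheses (D0 : 0 < D) (sigma0 : 0 < sigma) (alpha12 : 1 < alpha <= 2)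
  (eta0 : 0 < eta) (eps0 : 0 < eps).

Local Notation B := (noise_coef D sigma alpha eta).

Lemma noise_coef_gt0 : 0 < B.
Proof.
by case/andP: alpha12 => a1 _; rewrite !mulr_gt0 ?powR_gt0 ?divr_gt0 ?mulr_gt0 ?subr_gt0//; lra.
Qed.

Lemma noise_term_le (d s : R) : 0 <= d <= D -> 0 <= s ->
  eta * s * d <= d ^+ 2 / 8 + B * (s `^ alpha / sigma `^ alpha).
Proof.
move=> /andP[]; rewrite le_eqVlt => /predU1P[<- _ _|d0 dD].
  rewrite mulr0 expr0n mul0r add0r mulr_ge0 ?divr_ge0 ?powR_ge0//.
  exact/ltW/noise_coef_gt0.
case/andP: alpha12 => a1 a2.
rewrite le_eqVlt => /predU1P[<-|s0].
  rewrite mulr0 mul0r addr_ge0 ?divr_ge0 ?sqr_ge0//.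
  by rewrite mulr_ge0 ?divr_ge0 ?powR_ge0// ltW// noise_coef_gt0.
have a0 : 0 < alpha by lra.
have a10 : 0 < alpha - 1 by lra.
(* Young's inequality is applied to [eta * s / k] and [k * d] with exponents [alpha] and
   [alpha / (alpha - 1)]. This [k] makes the second term [d ^+ 2 / 8] times a nonnegative power of
   [d / D <= 1], and the first term exactly the noise term. *)
pose k := (alpha / (8 * (alpha - 1))) `^ ((alpha - 1) / alpha) *
  D `^ (- ((2 - alpha) / alpha)).
have k0 : 0 < k by rewrite mulr_gt0 ?powR_gt0 ?divr_gt0 ?mulr_gt0.
have eskd : eta * s / k * (k * d) = eta * s * d by field; rewrite gt_eqF.
have pq1 : alpha^-1 + (alpha / (alpha - 1))^-1 = 1 by field; rewrite !gt_eqF.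
have := @conjugate_powR R (eta * s / k) (k * d) alpha (alpha / (alpha - 1)).
rewrite eskd => /(_ _ _ a0 _ pq1) young; apply: le_trans (young _ _ _) _; try (by apply/ltW; pos).
  by pos.
rewrite addrC; apply: lerD; last first.
  rewrite le_eqVlt; apply/orP; left; apply/eqP.
  rewrite /k /noise_coef; by_ln.
  by field; rewrite !gt_eqF.
have -> : (k * d) `^ (alpha / (alpha - 1)) / (alpha / (alpha - 1)) =
    d ^+ 2 / 8 * (d / D) `^ ((2 - alpha) / (alpha - 1)).
  rewrite /k; by_ln.
  by field; rewrite !gt_eqF.
rewrite ler_piMr ?divr_ge0 ?sqr_ge0// -[X in _ <= X](powRr0 (d / D)).
have dD1 : 0 < d / D <= 1 by rewrite divr_gt0//= ler_pdivrMr// mul1r.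
apply: (ger_powR dD1); apply: divr_ge0; lra.
Qed.

(** Weighted AM-GM with weights [alpha - 1] and [2 - alpha]: the left side is exactly [u]^ (alpha -
    1) * (eta * eps / 8) [^ (2 - alpha)]. The factor [c] is [1] for the expectation and
    [1 + ln (2 / delta)] for the tail bound, where its power is the one in [tLambda_sq]. *)
Lemma noise_coef_le (c : R) : 0 < c ->
  B * c <= eta ^+ 2 * (c `^ (alpha - 1)^-1 * Lambda_sq D sigma alpha eps)
    + (2 - alpha) * (eta * eps / 8).
Proof.
move=> c0; case/andP: alpha12 => a1 a2.
have a0 : 0 < alpha by lra.
have a10 : 0 < alpha - 1 by lra.
have L0 : 0 < Lambda_sq D sigma alpha eps.
  by rewrite /Lambda_sq; pos.
pose u := eta ^+ 2 * (c `^ (alpha - 1)^-1 * Lambda_sq D sigma alpha eps) / (alpha - 1).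
have u0 : 0 < u by pos.
have v0 : 0 < eta * eps / 8 by rewrite divr_gt0 ?mulr_gt0.
have t01 : 0 <= alpha - 1 <= 1 by lra.
have := powR_weighted_am_gm (ltW u0) (ltW v0) t01.
have -> : 1 - (alpha - 1) = 2 - alpha by ring.
have -> : (alpha - 1) * u = eta ^+ 2 * (c `^ (alpha - 1)^-1 * Lambda_sq D sigma alpha eps).
  by rewrite /u; field; rewrite gt_eqF.
congr (_ <= _); rewrite /u /Lambda_sq /noise_coef; by_ln.
by field; rewrite !gt_eqF.
Qed.

End ErrorTerms.

(** * The step size *)

Section StepSize.
Context {R : realType}.
Variables (Lf Mf D Le Lam : R) (K : nat).
Hypotheses (LfLe0 : 0 <= Lf + Le) (D0 : 0 < D) (Lam0 : 0 < Lam) (K0 : (0 < K)%N).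

Local Notation eta := (stepsize Lf Mf D Le Lam K).
Local Notation S := (Num.sqrt (2 * K%:R * (Mf ^+ 2 + Lam ^+ 2))).

Let KR0 : 0 < K%:R :> R. Proof. by rewrite ltr0n. Qed.

Let S2_gt0 : 0 < 2 * K%:R * (Mf ^+ 2 + Lam ^+ 2).
Proof. by have := exprn_gt0 2 Lam0; have := sqr_ge0 Mf => *; pos. Qed.

Let S0 : 0 < S. Proof. by rewrite sqrtr_gt0. Qed.

(** The minimum lies below both quotients and equals one of them. Written with products, this also
    covers [Lf + Le = 0], where the first quotient is infinite. *)
Lemma stepsizeP : [/\ 0 < eta, eta * (4 * (Lf + Le)) <= 1, eta * S <= D &
  eta * (4 * (Lf + Le)) = 1 \/ eta * S = D].
Proof.
rewrite /stepsize; set a := 4 * (Lf + Le).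
have a0 : 0 <= a by rewrite mulr_ge0.
have DS0 : 0 < D / S by rewrite divr_gt0.
rewrite !inver (gt_eqF S0) -EFinM.
move: a0; rewrite le_eqVlt => /predU1P[<-|a0].
  rewrite eqxx mul1e minye /= mulr0 divfK ?gt_eqF//.
  by split; rewrite ?ler01//; right.
rewrite (gt_eqF a0) mul1e -EFin_min /=.
have a'0 : 0 < a^-1 by rewrite invr_gt0.
have aa : a^-1 * a = 1 by rewrite mulVf// gt_eqF.
have DS : D / S * S = D by rewrite divfK ?gt_eqF.
case: (leP a^-1 (D / S)) => aDS.
  split => //; [by rewrite aa|by rewrite -ler_pdivlMr|by left].
split => //; [|by rewrite DS|by right].
by rewrite -[leRHS]aa ler_pM2r// ltW.
Qed.

(* The step size balances the two sources of error: either it is the curvature bound,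
   and then [K] is large compared with [Lf + Le], or it is [D / S]. *)
Lemma stepsize_budget (eps b : R) : 0 < eps -> 0 <= Mf -> 0 <= b <= 2^-1 ->
  8 * D ^+ 2 * (Lf + Le) / eps <= K%:R ->
  2 * D ^+ 2 * (Mf + Lam) ^+ 2 / eps ^+ 2 <= b ^+ 2 * K%:R ->
  D ^+ 2 / 2 <= K%:R * eta * (eps / 4) /\
  K%:R * (2 * eta ^+ 2 * Mf ^+ 2 + eta ^+ 2 * Lam ^+ 2) <= b * (K%:R * eta * eps).
Proof.
move=> e0 M0 /andP[b0 b12]; rewrite !ler_pdivrMr ?exprn_gt0// => K1 K2.
have [eta0 ea eS eaS] := stepsizeP.
have SS : S ^+ 2 = 2 * K%:R * (Mf ^+ 2 + Lam ^+ 2) by rewrite sqr_sqrtr// ltW.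
(* Compare squares, using [Mf ^+ 2 + Lam ^+ 2 <= (Mf + Lam) ^+ 2]. *)
have SD : S * D <= b * (K%:R * eps).
  rewrite -ler_sqr ?nnegrE; [|by apply/ltW; pos|by rewrite !mulr_ge0 ?ler0n// ltW].
  rewrite exprMn SS.
  have h : K%:R * (2 * D ^+ 2 * (Mf + Lam) ^+ 2) <= K%:R * (b ^+ 2 * K%:R * eps ^+ 2).
    by rewrite ler_pM2l.
  have : 0 <= K%:R * D ^+ 2 * (Mf * Lam) by rewrite !mulr_ge0 ?sqr_ge0// ltW.
  have -> : (b * (K%:R * eps)) ^+ 2 = K%:R * (b ^+ 2 * K%:R * eps ^+ 2) by ring.
  nra.
split.
  case: eaS => [ea1|eS1].
    have : eta * (8 * D ^+ 2 * (Lf + Le)) <= eta * (K%:R * eps) by rewrite ler_pM2l.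
    have -> : eta * (8 * D ^+ 2 * (Lf + Le)) = 2 * D ^+ 2 * (eta * (4 * (Lf + Le))) by ring.
    by rewrite ea1; lra.
  have : eta * (S * D) <= eta * (b * (K%:R * eps)) by rewrite ler_pM2l.
  have -> : eta * (S * D) = D ^+ 2 by rewrite [LHS]mulrA eS1.
  move=> h.
  have : 0 <= (2^-1 - b) * (eta * (K%:R * eps)) by rewrite mulr_ge0 ?subr_ge0//; apply/ltW; pos.
  lra.
(* From [eta * S <= D] follows [(eta * S) ^+ 2 <= eta * (S * D)]; the left side is twice the sum of
   the two squared terms, with the factor [K%:R]. *)
have h : eta * (eta * S) * S <= eta * D * S.
  by rewrite ler_pM2r// ler_pM2l.
have : eta * (S * D) <= eta * (b * (K%:R * eps)) by rewrite ler_pM2l.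
have e2 : eta * (eta * S) * S = eta ^+ 2 * (2 * K%:R * (Mf ^+ 2 + Lam ^+ 2)).
  by rewrite -[in RHS]SS; ring.
have : 0 <= eta ^+ 2 * K%:R * Lam ^+ 2 by apply/ltW; pos.
move: h; rewrite e2; lra.
Qed.

End StepSize.

(** * The Chernoff parameter *)

Section Chernoff.
Context {R : realType}.

(* [lam] and [phi] are a Chernoff parameter and a bound on the log-Laplace transform of
   [y]; the affine majorant integrates to at most [1] when [y] is centred and [expR X]
   has mean at most [expR 1]. *)
Lemma chernoff_parameter (alpha r lnd K : R) : 1 < alpha <= 2 -> 0 < r -> 0 < lnd ->
  ((alpha / r) `^ (alpha / (alpha - 1)) + (1 < alpha < 2)%R%:R) * (lnd / (alpha - 1)) <= K ->
  exists lam phi a b : R, [/\ 0 < lam, 0 <= b <= 1, lnd <= K * (lam * r - phi) &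
    forall y X : R, `|y| `^ alpha <= X ->
      expR (lam * y - phi) <= a * y + (b * expR (X - 1) + (1 - b))].
Proof.
move=> a12 r0 ln0 hK; case/andP: (a12) => a1 a2.
have a0 : 0 < alpha by lra.
have a10 : 0 < alpha - 1 by lra.
have case1 (lam : R) : 0 < lam <= 1 -> lnd <= K * (lam * r - lam `^ alpha) ->
  exists lam phi a b : R, [/\ 0 < lam, 0 <= b <= 1, lnd <= K * (lam * r - phi) &
    forall y X : R, `|y| `^ alpha <= X ->
      expR (lam * y - phi) <= a * y + (b * expR (X - 1) + (1 - b))].
  move=> /andP[l0 l1] hl; have t0 : 0 <= lam `^ alpha by exact: powR_ge0.
  have t1 : lam `^ alpha <= 1.
    have : lam `^ alpha <= 1 `^ alpha by apply: ge0_ler_powR; rewrite ?nnegrE// ltW.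
    by rewrite powR1.
  exists lam, (lam `^ alpha), (expR (- lam `^ alpha) * lam), (lam `^ alpha).
  split => //; first by rewrite t0.
  move=> y X yX; set t := lam `^ alpha in t0 t1 *.
  have h1 : expR (lam * y) <= lam * y + expR (t * X).
    apply: le_trans (@expR_le_add_expR_powR _ alpha _ _) _; first by rewrite ltW.
    rewrite lerD2l ler_expR normrM powRM// (gtr0_norm l0).
    by rewrite ler_wpM2l.
  have h2 : expR (t * (X - 1)) <= t * expR (X - 1) + (1 - t).
    by apply: expR_scale_le; rewrite t0.
  have e0 := expR_gt0 (- t).
  rewrite [expR (_ - t)]expRD.
  have : expR (lam * y) * expR (- t) <= (lam * y + expR (t * X)) * expR (- t).
    by rewrite ler_pM2r.
  have e3 : expR (t * X) * expR (- t) = expR (t * (X - 1)) by rewrite -expRD; congr expR; ring.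
  by rewrite mulrDl e3 => /le_trans; apply; rewrite [lam * y * _]mulrC mulrA lerD2l.
have K0 : 0 < K.
  by apply: lt_le_trans hK; rewrite mulr_gt0 ?divr_gt0// ltr_wpDr ?ler0n// powR_gt0 ?divr_gt0.
have [ra|ar] := leP r alpha.
  pose lam := (r / alpha) `^ (alpha - 1)^-1.
  have l0 : 0 < lam by rewrite powR_gt0 ?divr_gt0.
  have ral0 : 0 <= r / alpha by rewrite divr_ge0// ltW.
  have l1 : lam <= 1.
    have : lam <= 1 `^ (alpha - 1)^-1.
      by apply: ge0_ler_powR; rewrite ?nnegrE ?invr_ge0 ?ler_pdivrMr ?mul1r// ltW.
    by rewrite powR1.
  apply: (case1 lam); first by rewrite l0.
  have lE : lam * r - lam `^ alpha = (alpha - 1) / (alpha / r) `^ (alpha / (alpha - 1)).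
    have lal : lam `^ alpha = lam * (r / alpha).
      by rewrite /lam; by_ln; field; rewrite !gt_eqF.
    have -> : (alpha / r) `^ (alpha / (alpha - 1)) = (lam * (r / alpha))^-1.
      by rewrite /lam; by_ln; field; rewrite !gt_eqF.
    by rewrite lal; field; rewrite !gt_eqF.
  rewrite lE mulrA ler_pdivlMr ?powR_gt0 ?divr_gt0// mulrC -ler_pdivrMr//.
  apply: le_trans hK; rewrite -mulrA ler_pM2r ?divr_gt0//.
  by rewrite lerDl ler0n.
(* For [r > alpha] and [alpha < 2], [lam = 1] gains [r - 1 > alpha - 1] per step; the indicator in
   the hypothesis makes [K] large enough for that. *)
have [a2'|] := ltP alpha 2.
  apply: (case1 1); first by rewrite ltr01 lexx.
  rewrite powR1 mul1r.
  have : 1 * (lnd / (alpha - 1)) <= K.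
    apply: le_trans hK; rewrite ler_pM2r ?divr_gt0// a1 a2' /= lerDr powR_ge0//.
  rewrite mul1r ler_pdivrMr// => /le_trans; apply.
  by rewrite ler_pM2l// lerD2r ltW.
move=> a2'; have aE : alpha = 2 by apply/eqP; rewrite eq_le a2.
(* For [alpha = 2] the indicator vanishes and a larger parameter is taken:
   [2 * r * y <= r ^+ 2 + y ^+ 2] bounds the exponential by [expR (X - 1)] with no linear term, and
   the gain is [r ^+ 2 - 1]. *)
exists (2 * r), (r ^+ 2 + 1), 0, 1; split; [by rewrite mulr_gt0|by rewrite lexx ler01| |].
  have := hK; rewrite aE ltxx andbF addr0.
  have -> : 2 / (2 - 1) = 2%:R :> R by field.
  have -> : lnd / (2 - 1) = lnd by field.
  have r20 : 0 <= 2 / r by rewrite divr_ge0 ?ltW.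
  rewrite (powR_mulrn 2 r20) expr_div_n mulrAC ler_pdivrMr ?exprn_gt0// => h.
  have r2 : 2 < r by rewrite -aE.
  have : 0 <= K * (r ^+ 2 - 4) by rewrite mulr_ge0 ?ltW//; nra.
  lra.
move=> y X; rewrite aE (powR_mulrn 2 (normr_ge0 y)) real_normK ?num_real// => yX.
by rewrite mul0r add0r subrr addr0 mul1r ler_expR; have := sqr_ge0 (r - y); lra.
Qed.

End Chernoff.

(** * Independence and Markov chains *)

Section Independence.
Context {R : realType} {d1 d2 d' : measure_display}.
Context {T : measurableType d1} {Xi : measurableType d2} {Omega : measurableType d'}.
Variables (P : probability Omega R) (mu : probability Xi R).

(** The law of the pair agrees with the product measure on rectangles, hence everywhere; Tonelli's
    theorem then gives the iterated integral. *)
Lemma integral_independent_pair (X : Omega -> T) (Y : Omega -> Xi)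
    (phi : T * Xi -> \bar R) :
  measurable_fun setT X -> measurable_fun setT Y ->
  (forall A B, measurable A -> measurable B ->
    P (X @^-1` A `&` Y @^-1` B) = (P (X @^-1` A) * mu B)%E) ->
  measurable_fun [set: T * Xi] phi -> (forall z, 0 <= phi z)%E ->
  (\int[P]_w phi (X w, Y w) = \int[P]_w \int[mu]_s phi (X w, s))%E.
Proof.
move=> mX mY XY mphi phi0.
have mXY : measurable_fun setT (fun w => (X w, Y w)) by exact: measurable_fun_pair.
pose X' : {mfun Omega >-> T} := HB.pack X (isMeasurableFun.Build _ _ _ _ X mX).
pose XY' : {mfun Omega >-> (T * Xi)%type} :=
  HB.pack (fun w => (X w, Y w)) (isMeasurableFun.Build _ _ _ _ _ mXY).
have -> : (\int[P]_w phi (X w, Y w) = \int[distribution P XY']_z phi z)%E.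
  by rewrite ge0_integral_distribution.
have -> : (\int[distribution P XY']_z phi z = \int[distribution P X' \x mu]_z phi z)%E.
  apply: eq_measure_integral => A mA _; apply/esym.
  by apply: product_measure_unique => // B C mB mC; exact: XY.
rewrite fubini_tonelli1// ge0_integral_distribution//.
- exact: measurable_fun_fubini_tonelli_F.
- by move=> x; apply: integral_ge0.
Qed.

End Independence.

(** * Chains driven by independent samples *)

Section Chain.
Context {R : realType} {d1 d2 d' : measure_display}.
Context {T : measurableType d1} {Xi : measurableType d2} {Omega : measurableType d'}.
Variables (P : probability Omega R) (mu : probability Xi R) (xi : nat -> Omega -> Xi).
Hypothesis hxi : iid_samples P mu xi.

(* A pi-system generating the sigma-algebra of the samples [xi 0, ..., xi (k - 1)]. *)
Definition past_cylinders (k : nat) : set (set Omega) :=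
  [set E | exists2 A : nat -> set Xi, (forall j, measurable (A j)) &
    E = \bigcap_(j in `I_k) (xi j @^-1` A j)].

Lemma past_cylinders_measurable k : past_cylinders k `<=` measurable.
Proof.
move=> _ [A mA ->]; case: hxi => mxi _ _; case: k => [|k].
  by rewrite (_ : \bigcap_(j in _) _ = setT)//; apply/seteqP; split.
apply: bigcap_measurable => [|j _]; first by exists 0%N.
by rewrite -[X in measurable X]setTI; apply: mxi.
Qed.

Lemma past_cylindersS k : past_cylinders k `<=` past_cylinders k.+1.
Proof.
move=> _ [A mA ->]; exists (fun j => if (j < k)%N then A j else setT).
  by move=> j; case: ifP.
apply/seteqP; split=> w h j /= jk; first by case: ifP => // jk'; exact: h.
by have := h j (leqW jk); rewrite jk.
Qed.

(** For fixed [B] both sides are finite measures in [E]; they agree on the cylinders, a pi-system,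
    and hence on the sigma-algebra it generates. *)
Lemma past_independent k (E : set Omega) (B : set Xi) : <<s past_cylinders k >> E ->
  measurable B -> P (E `&` xi k @^-1` B) = (P E * mu B)%E.
Proof.
case: (hxi) => mxi lxi ixi pE mB.
have mxB : measurable (xi k @^-1` B) by rewrite -[X in measurable X]setTI; apply: mxi.
have muBE : mu B = (fine (mu B))%:E by rewrite fineK// fin_num_measure.
have fB0 : 0 <= fine (mu B) by rewrite fine_ge0.
rewrite muleC muBE -[LHS]/(mrestr P mxB E).
rewrite -[RHS]/(mscale (NngNum fB0) P E).
apply: (g_sigma_algebra_measure_unique (past_cylinders k) _ (fun=> setT)) => //.
- exact: past_cylinders_measurable.
- move=> _; exists (fun=> setT) => //; apply/esym/seteqP; split => //.
- by apply/seteqP; split => // w _; exists 0%N.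
- move=> _ _ [A mA ->] [A' mA' ->]; exists (fun j => A j `&` A' j).
    by move=> j; apply: measurableI.
  by rewrite -bigcapI.
- move=> _ [A mA ->]; rewrite -[RHS]/((fine (mu B))%:E * P _)%E -muBE /mrestr.
  (* Mutual independence is used twice, for the indices below [k] and for these together with [k];
     the two products differ by the factor [mu B]. *)
  pose A' j := if j == k then B else A j.
  have mA' j : measurable (A' j) by rewrite /A'; case: ifP.
  have IE : `I_k = [set` iota 0 k].
    by apply/seteqP; split => j /=; rewrite mem_iota.
  have := ixi (k :: iota 0 k) A'; rewrite /= mem_iota add0n ltnn andbF iota_uniq.
  move=> /(_ isT mA'); rewrite big_cons {2}/A' eqxx lxi// => kE.
  have := ixi (iota 0 k) A (iota_uniq _ _) mA; rewrite -IE => ->.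
  have -> : (\prod_(j <- iota 0 k) P (xi j @^-1` A j) =
             \prod_(j <- iota 0 k) P (xi j @^-1` A' j))%E.
    apply: eq_big_seq => j; rewrite mem_iota add0n /= /A'.
    by case: eqP => // ->; rewrite ltnn.
  rewrite -kE; congr (P _); apply/seteqP; split => w.
    move=> [h1 h2] j /=; rewrite inE /A'; case: eqP => [-> //|_ /=].
    by rewrite mem_iota => jk; exact: h1.
  move=> h; split => [j /= jk|].
    have := h j; rewrite /= inE mem_iota /= add0n jk orbT /A'.
    by case: eqP jk => [->|_ _]; [rewrite ltnn|exact].
  by have := h k; rewrite /= mem_head /A' eqxx; apply.
- by move=> _; rewrite /mrestr (le_lt_trans (probability_le1 _ _)) ?ltry// setTI.
Qed.

Variables (Phi : nat -> T * Xi -> T) (z0 : T) (Z : nat -> Omega -> T).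
Hypotheses (mPhi : forall k, measurable_fun [set: T * Xi] (Phi k))
  (Z0 : forall w, Z 0%N w = z0) (ZS : forall k w, Z k.+1 w = Phi k (Z k w, xi k w)).

(** By induction, [Z k] is a function of the samples before [k] only; this is what makes it
    independent of [xi k]. *)
Lemma chain_adapted k :
  measurable_fun setT (Z k : g_sigma_algebraType (past_cylinders k) -> T).
Proof.
case: (hxi) => mxi _ _; elim: k => [|k IHk].
  by rewrite (_ : Z 0%N = cst z0)//; apply/funext => w; exact: Z0.
rewrite (_ : Z k.+1 = fun w => Phi k (Z k w, xi k w)); last by apply/funext.
apply: (measurableT_comp (mPhi k)); apply: measurable_fun_pair.
  move=> _ B mB; have := IHk measurableT B mB.
  by apply: sub_sigma_algebra2; exact: past_cylindersS.
move=> _ B mB; apply: sub_sigma_algebra.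
exists (fun j => if j == k then B else setT) => [j|]; first by case: ifP.
rewrite setTI; apply/seteqP; split => w.
  by move=> h j _; case: eqP => [->|].
by move=> h; have := h k (ltnSn k); rewrite eqxx.
Qed.

Lemma chain_measurable k : measurable_fun setT (Z k).
Proof.
move=> _ B mB; have past := chain_adapted (k := k) measurableT mB.
have sub := (smallest_sub (@sigma_algebra_measurable _ Omega) (@past_cylinders_measurable k)).
exact: sub past.
Qed.

(** Conditioning on the past: the next sample can be integrated out while the state is frozen. *)
Lemma chain_integral k (phi : T * Xi -> \bar R) :
  measurable_fun [set: T * Xi] phi -> (forall z, 0 <= phi z)%E ->
  (\int[P]_w phi (Z k w, xi k w) = \int[P]_w \int[mu]_s phi (Z k w, s))%E.
Proof.
case: (hxi) => mxi _ _; apply: integral_independent_pair => //.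
  exact: chain_measurable.
move=> A B mA mB; apply: past_independent => //.
by have := chain_adapted (k := k) measurableT mA; rewrite setTI.
Qed.

End Chain.

Lemma fin_num_sube_eq0 (R : realType) (a b : \bar R) : a \is a fin_num ->
  b \is a fin_num -> (a - b = 0)%E -> a = b.
Proof. by move: a b => [a| |] [b| |]//= _ _ [/subr0_eq ->]. Qed.

Lemma integral_cst_probability {R : realType} {d : measure_display} {T : measurableType d}
  (P : probability T R) (r : R) : (\int[P]_w r%:E = r%:E)%E.
Proof.
rewrite (integral_cst P _ r%:E)// -[RHS]mule1; congr (_ * _)%E.
exact: probability_setT.
Qed.

(** * Products and centred terms along a chain *)

Section ChainExpectation.
Context {R : realType} {d1 d2 d' : measure_display}.
Context {T : measurableType d1} {Xi : measurableType d2} {Omega : measurableType d'}.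
Variables (P : probability Omega R) (mu : probability Xi R) (xi : nat -> Omega -> Xi).
Hypothesis hxi : iid_samples P mu xi.
Variables (Phi : nat -> T * Xi -> T) (z0 : T) (Z : nat -> Omega -> T) (D : set T).
Hypotheses (mPhi : forall k, measurable_fun [set: T * Xi] (Phi k))
  (Z0 : forall w, Z 0%N w = z0) (ZS : forall k w, Z k.+1 w = Phi k (Z k w, xi k w))
  (DZ : forall k w, D (Z k w)).

Lemma chain_comp_measurable k (psi : T * Xi -> R) : measurable_fun [set: T * Xi] psi ->
  measurable_fun setT (fun w => psi (Z k w, xi k w)).
Proof.
case: (hxi) => mxi _ _ mpsi; apply: (measurableT_comp mpsi).
by apply: measurable_fun_pair => //; exact: (chain_measurable hxi mPhi Z0 ZS).
Qed.

(* The running product is carried along as a second component of the chain. *)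
Lemma chain_prod_integral_le1 (psi : T * Xi -> R) k :
  measurable_fun [set: T * Xi] psi -> (forall z, 0 <= psi z) ->
  (forall z, D z -> \int[mu]_s (psi (z, s))%:E <= 1)%E ->
  (\int[P]_w (\prod_(j < k) psi (Z j w, xi j w))%:E <= 1)%E.
Proof.
move=> mpsi psi0 psi1.
elim: k => [|k IHk].
  under eq_integral do rewrite big_ord0.
  by rewrite integral_cst_probability.
pose U k w := \prod_(j < k) psi (Z j w, xi j w).
have U0 j w : 0 <= U j w by apply: prodr_ge0.
pose Z' k w : T * R := (Z k w, U k w).
pose Phi' k (p : (T * R) * Xi) : T * R := (Phi k (p.1.1, p.2), p.1.2 * psi (p.1.1, p.2)).
have m11 : measurable_fun [set: (T * R) * Xi] (fun p : (T * R) * Xi => (p.1.1, p.2)).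
  apply: measurable_fun_pair => //; apply: measurableT_comp => //.
have mPhi' j : measurable_fun [set: (T * R) * Xi] (Phi' j).
  apply: measurable_fun_pair; first exact: measurableT_comp.
  apply: measurable_funM; last exact: measurableT_comp.
  exact: measurableT_comp.
have Z'0 w : Z' 0%N w = (z0, 1) by rewrite /Z' /U big_ord0 Z0.
have Z'S j w : Z' j.+1 w = Phi' j (Z' j w, xi j w).
  by rewrite /Z' /Phi' /U big_ord_recr ZS.
(* The absolute value makes [phi] nonnegative on the whole product space, whose second component may
   be negative; along the chain it changes nothing. *)
pose phi (p : (T * R) * Xi) : \bar R := (`|p.1.2 * psi (p.1.1, p.2)|)%:E.
have mphi : measurable_fun [set: (T * R) * Xi] phi.
  apply/measurable_EFinP; apply: measurableT_comp => //.
  apply: measurable_funM; last exact: measurableT_comp.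
  exact: measurableT_comp.
have phi0 p : (0 <= phi p)%E by rewrite /phi lee_fin.
have mZ' := chain_measurable hxi mPhi' Z'0 Z'S k.
have -> : (\int[P]_w (\prod_(j < k.+1) psi (Z j w, xi j w))%:E =
           \int[P]_w phi (Z' k w, xi k w))%E.
  apply: eq_integral => w _; rewrite /phi /= ger0_norm ?mulr_ge0//.
  by rewrite big_ord_recr.
rewrite (chain_integral hxi mPhi' Z'0 Z'S)//; apply: le_trans IHk.
have mU : measurable_fun setT (EFin \o U k).
  by apply/measurable_EFinP; apply: (measurableT_comp measurable_snd mZ').
apply: ge0_le_integral => //.
- by move=> w _; apply: integral_ge0.
- exact: (measurableT_comp (measurable_fun_fubini_tonelli_F phi mphi phi0) mZ').
move=> w _; have -> : (\int[mu]_s phi (Z' k w, s) =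
    \int[mu]_s ((U k w)%:E * (psi (Z k w, s))%:E))%E.
  by apply: eq_integral => s _; rewrite /phi /= ger0_norm ?mulr_ge0.
have mps : measurable_fun setT (fun s => (psi (Z k w, s))%:E).
  by apply/measurable_EFinP; exact: measurable_fun_pair2.
rewrite ge0_integralZl_EFin//; first last.
- by move=> s _; rewrite lee_fin.
by rewrite -[leRHS]mule1 lee_wpmul2l ?lee_fin// psi1.
Qed.

Lemma chain_prod_measurable (psi : T * Xi -> R) k : measurable_fun [set: T * Xi] psi ->
  measurable_fun setT (fun w => \prod_(j < k) psi (Z j w, xi j w)).
Proof. by move=> mpsi; apply: measurable_prod => j _; exact: chain_comp_measurable. Qed.

Lemma chain_prod_superlevel_measurable (psi : T * Xi -> R) k (c : R) :
  measurable_fun [set: T * Xi] psi ->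
  measurable [set w | c <= \prod_(j < k) psi (Z j w, xi j w)].
Proof.
move=> mpsi; rewrite -[X in measurable X]setTI.
by apply: measurable_fun_le => //; exact: chain_prod_measurable.
Qed.

Lemma chain_prod_markov (psi : T * Xi -> R) k (c : R) : 0 < c ->
  measurable_fun [set: T * Xi] psi -> (forall z, 0 <= psi z) ->
  (forall z, D z -> \int[mu]_s (psi (z, s))%:E <= 1)%E ->
  (P [set w | c <= \prod_(j < k) psi (Z j w, xi j w)]%R <= (c^-1)%:E)%E.
Proof.
move=> c0 mpsi psi0 psi1; have le1 := chain_prod_integral_le1 k mpsi psi0 psi1.
pose g w := (\prod_(j < k) psi (Z j w, xi j w))%:E.
have g0 w : 0 <= \prod_(j < k) psi (Z j w, xi j w) by apply: prodr_ge0.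
have mg : measurable_fun setT g by apply/measurable_EFinP; exact: chain_prod_measurable.
have := le_integral_abse P measurableT mg c0.
under [X in (_ <= X)%E]eq_integral do rewrite /g /= ger0_norm//.
move=> /le_trans/(_ le1).
rewrite setTI (_ : [set w | _] = [set w | c <= \prod_(j < k) psi (Z j w, xi j w)]).
  by rewrite -lee_pdivlMl// mule1.
by apply/seteqP; split => w /=; rewrite lee_fin ger0_norm.
Qed.

(** Conditionally centred terms are centred. The conditioning identity is for nonnegative functions,
    so it is applied to the positive and negative parts, whose inner integrals are finite and
    coincide in every state of the chain. *)
Lemma chain_integral_eq0 (psi : T * Xi -> R) (C : R) k :
  measurable_fun [set: T * Xi] psi ->
  (forall z, D z -> \int[mu]_s `|(psi (z, s))%:E| <= C%:E)%E ->
  (forall z, D z -> \int[mu]_s (psi (z, s))%:E = 0)%E ->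
  P.-integrable setT (fun w => (psi (Z k w, xi k w))%:E) /\
  (\int[P]_w (psi (Z k w, xi k w))%:E = 0)%E.
Proof.
move=> mpsi psiC psi0; pose f : T * Xi -> \bar R := EFin \o psi.
have mf : measurable_fun [set: T * Xi] f by apply/measurable_EFinP.
have mZ := chain_measurable hxi mPhi Z0 ZS k.
have maf : measurable_fun [set: T * Xi] (abse \o f) by exact: measurableT_comp.
have af0 z : (0 <= (abse \o f) z)%E by exact: abse_ge0.
have fint : P.-integrable setT (fun w => f (Z k w, xi k w)).
  apply/integrableP; split.
    by apply/measurable_EFinP; exact: chain_comp_measurable.
  rewrite (chain_integral hxi mPhi Z0 ZS k maf af0).
  apply: (@le_lt_trans _ _ (\int[P]_w (cst C%:E w))%E); last first.
    by rewrite integral_cst_probability ltry.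
  apply: ge0_le_integral => //.
  - by move=> w _; apply: integral_ge0.
  - exact: (measurableT_comp (measurable_fun_fubini_tonelli_F _ maf af0) mZ).
  - by move=> w _; exact: psiC.
split=> //; rewrite integralE.
have -> : (\int[P]_w (fun w => f (Z k w, xi k w))^\+ w =
           \int[P]_w (fun w => f (Z k w, xi k w))^\- w)%E; last first.
  rewrite subee//; apply: integrable_fin_num => //; exact: integrable_funeneg.
have mfp : measurable_fun [set: T * Xi] (f^\+)%E by exact: measurable_funepos.
have mfn : measurable_fun [set: T * Xi] (f^\-)%E by exact: measurable_funeneg.
have pE := chain_integral hxi mPhi Z0 ZS k mfp (funepos_ge0 f).
have nE := chain_integral hxi mPhi Z0 ZS k mfn (funeneg_ge0 f).
transitivity (\int[P]_w \int[mu]_s f^\+ (Z k w, s))%E.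
  by rewrite -pE; apply: eq_integral => w _; rewrite !funeposE.
transitivity (\int[P]_w \int[mu]_s f^\- (Z k w, s))%E; last first.
  by rewrite -nE; apply: eq_integral => w _; rewrite !funenegE.
apply: eq_integral => w _.
have mfw : measurable_fun setT (fun s => f (Z k w, s)) by exact: measurable_fun_pair2.
have fw : mu.-integrable setT (fun s => f (Z k w, s)).
  by apply/integrableP; split=> //; apply: le_lt_trans (psiC _ (DZ k w)) (ltry _).
have posfin := integrable_pos_fin_num measurableT fw.
have negfin := integrable_neg_fin_num measurableT fw.
have := psi0 _ (DZ k w); rewrite integralE => e0.
transitivity (\int[mu]_s (fun s => f (Z k w, s))^\+ s)%E.
  by apply: eq_integral => s _; rewrite !funeposE.
rewrite (fin_num_sube_eq0 posfin negfin e0).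
by apply: eq_integral => s _; rewrite !funenegE.
Qed.

End ChainExpectation.

(** * Borel measurability *)

Section BorelMeasurability.
Context {R : realType} {n : nat}.

Lemma borel_measurable_lsc (f : 'rV[R]_n -> \bar R) : lower_semicontinuous f ->
  measurable_fun setT (f : borelRn R n -> \bar R).
Proof.
move=> lf; apply: (measurability _ (ErealGenOInfty.measurableE R)).
move=> _ [_ [a ->]] <-; rewrite setTI; apply: sub_sigma_algebra.
by rewrite preimage_itvoy; move/lower_semicontinuousP : lf; exact.
Qed.

Lemma borel_measurable_continuous (g : 'rV[R]_n -> R) : continuous g ->
  measurable_fun setT (g : borelRn R n -> R).
Proof.
move=> cg; apply/measurable_EFinP; apply: borel_measurable_lsc.
exact: lower_semicontinuous_EFin.
Qed.

Lemma coord_measurable i : measurable_fun setT (fun x : borelRn R n => (x : 'rV[R]_n) 0 i).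
Proof. by apply: borel_measurable_continuous; exact: coord_continuous. Qed.

(* An open set is a countable union of boxes with rational centers. *)
Lemma measurable_fun_borelRn d (T : measurableType d) (X : T -> 'rV[R]_n) :
  (forall i, measurable_fun setT (fun t => X t 0 i)) ->
  measurable_fun setT (X : T -> borelRn R n).
Proof.
move=> mX; apply: (@measurability _ _ _ (borelRn R n) _ _ (@open 'rV[R]_n)) => //.
move=> _ [U oU <-]; rewrite setTI.
pose box (p : {ffun 'I_n -> rat} * nat) : set 'rV[R]_n :=
  [set y | forall i, `|y 0 i - ratr (p.1 i)| < p.2.+1%:R^-1].
pose F p := if `[< box p `<=` U >] then X @^-1` box p else set0.
have -> : X @^-1` U = \bigcup_p F p.
  apply/seteqP; split => [t Ut|t [p _]]; last first.
    by rewrite /F; case: asboolP => // pU /pU.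
  have := oU; rewrite openE => /(_ _ Ut)/nbhs_ballP[e /= e0 eU].
  (* A box of half-width below [e / 2] that contains [X t] lies in the sup-norm ball of radius [e]
     about it. *)
  have [k ke] : exists k, k.+1%:R^-1 < e / 2.
    have [k _ /(_ _ (leqnn k))] := near_infty_natSinv_lt (PosNum (divr_gt0 e0 (ltr0Sn R 1))).
    by exists k.
  have k0 : 0 < k.+1%:R^-1 :> R by rewrite invr_gt0 ltr0n.
  set r : R := k.+1%:R^-1 in ke k0.
  have /choice[q qX] : forall i, exists q : rat, `|X t 0 i - ratr q| < r.
    move=> i; have [|q] := @rat_in_itvoo R (X t 0 i - r) (X t 0 i + r).
      lra.
    by rewrite in_itv /= => /andP[h1 h2]; exists q; rewrite ltr_norml; lra.
  exists ([ffun i => q i], k) => //; rewrite /F; case: asboolP => [_ /= i|nU].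
    by rewrite ffunE.
  case: nU => y yb; apply: eU; split => // i j.
  have := yb j; have := qX j; rewrite /= -/r ffunE ord1 /ball /= !ltr_norml; lra.
apply: countable_bigcupT_measurable => [|p]; first exact: countableP.
rewrite /F; case: asboolP => // _.
rewrite (_ : X @^-1` box p = \bigcap_(i in [set: 'I_n])
    [set t | `|X t 0 i - ratr (p.1 i)| < p.2.+1%:R^-1]); last first.
  by apply/seteqP; split => t /= h i; [move=> _|]; exact: h.
apply: fin_bigcap_measurable => // i _.
rewrite -[X in measurable X]setTI.
apply: measurable_fun_ltr => //.
apply: measurableT_comp => //; exact: measurable_funB.
Qed.

End BorelMeasurability.

(** * The descent inequality *)

Section ProximalContinuity.
Context {R : realType} {n : nat}.
Variables (h : 'rV[R]_n -> \bar R) (eta : R).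
Hypotheses (hh : proper_lsc_convex h)
  (hbnd : exists B : R, forall x, edom h x -> enorm x <= B) (eta0 : 0 < eta).

(** Adding the three-point inequalities at [v] and [w], each tested at the other proximal point,
    gives firm nonexpansiveness; Cauchy-Schwarz finishes. The resulting continuity yields measurable
    iterates. *)
Lemma prox_nonexpansive v w : enorm (prox eta h v - prox eta h w) <= enorm (v - w).
Proof.
have := prox_three_points hh hbnd eta0 v (prox_edom eta hh hbnd w).
have := prox_three_points hh hbnd eta0 w (prox_edom eta hh hbnd v).
move: (prox eta h v) (prox eta h w) => p q h1 h2.
have c0 : 0 < (2 * eta)^-1 by rewrite invr_gt0 mulr_gt0.
have pqvw : enorm (p - q) ^+ 2 <= dotv (p - q) (v - w).
  have polar : enorm (q - v) ^+ 2 + enorm (p - w) ^+ 2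
      = enorm (p - v) ^+ 2 + enorm (q - w) ^+ 2 + 2 * dotv (p - q) (v - w).
    have -> : q - v = (p - v) + (q - p) by rewrite [RHS]addrC addrA subrK.
    have -> : p - w = (q - w) + (p - q) by rewrite [RHS]addrC addrA subrK.
    rewrite (sqr_enormD (p - v)) (sqr_enormD (q - w)) (enormB q p) -(opprB p q) dotvNr.
    have -> : dotv (p - q) (v - w) =
        dotv (p - q) (p - q) - dotv (p - q) (p - v) + dotv (p - q) (q - w).
      by rewrite -dotvNr -dotvDr -dotvDr; congr dotv; apply/rowP => i; rewrite !mxE; ring.
    by rewrite !(dotvC _ (p - q)) -sqr_enorm; ring.
  rewrite -(ler_pM2l c0); move: h1 h2; rewrite (enormB q p).
  set c := (2 * eta)^-1 in c0 *.
  have : c * (enorm (q - v) ^+ 2 + enorm (p - w) ^+ 2) = c * (enorm (p - v) ^+ 2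
    + enorm (q - w) ^+ 2 + 2 * dotv (p - q) (v - w)) by rewrite polar.
  move: (enorm _) (enorm _) (enorm _) (enorm _) (enorm _) (dotv _ _) (fine _) (fine _).
  by move=> *; lra.
have [->|pq0] := eqVneq (enorm (p - q)) 0; first exact: enorm_ge0.
have {pq0} : 0 < enorm (p - q) by rewrite lt_neqAle eq_sym pq0 enorm_ge0.
move=> pq0; rewrite -(ler_pM2l pq0) -expr2.
exact: le_trans pqvw (dotv_le_enorm _ _).
Qed.

Lemma prox_coord_continuous i : continuous (fun v => prox eta h v 0 i).
Proof.
move=> v; apply/(@cvgrPdist_lt R R _ (nbhs v) _) => e e0; near=> w.
have -> : prox eta h v 0 i - prox eta h w 0 i = (prox eta h v - prox eta h w) 0 i.
  by rewrite !mxE.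
apply: le_lt_trans (coord_le_enorm _ _) _; apply: le_lt_trans (prox_nonexpansive _ _) _.
rewrite enormB -ltr_sqr ?nnegrE ?enorm_ge0 ?ltW//.
near: w; apply: (cvgr_lt (enorm (v - v) ^+ 2)); first exact: sqr_enormB_continuous.
by rewrite subrr sqr_enorm /dotv big1 ?exprn_gt0// => j _; rewrite mxE mul0r.
Unshelve. all: by end_near. Qed.

End ProximalContinuity.

(** * One-step descent and its sum *)

Section Descent.
Context {R : realType} {n : nat}.
Variables (f h : 'rV[R]_n -> \bar R) (Lf Hf Mf nu : R).
Hypotheses (hf : proper_lsc_convex f) (hh : proper_lsc_convex h)
  (hdom : edom h `<=` edom f)
  (hHf : 0 <= Hf) (hnu : 0 < nu < 1)
  (hsub : holder_like_subgradients f Lf Hf Mf nu)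
  (hbnd : exists B : R, forall x, edom h x -> enorm x <= B)
  (hDh : 0 < ediam (edom h))
  (ex_subgrad : forall x, edom f x -> exists g, subdifferential f x g).
Variables (sigma alpha eps eta : R).
Hypotheses (hsigma : 0 < sigma) (halpha : 1 < alpha <= 2) (heps : 0 < eps)
  (heta : 0 < eta) (hcurv : eta * (4 * (Lf + Leps Hf nu eps)) <= 1).

Local Notation D := (ediam (edom h)).
Local Notation B := (noise_coef D sigma alpha eta).

Definition objective (x : 'rV[R]_n) : R := fine (f x) + fine (h x).

Let f0 x : (-oo < f x)%E. Proof. by case: hf => -[]. Qed.
Let h0 x : (-oo < h x)%E. Proof. by case: hh => -[]. Qed.

Lemma objectiveE x : edom h x -> (f x + h x = (objective x)%:E)%E.
Proof. by move=> hx; rewrite EFinD !fineK_edom//; exact: hdom. Qed.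

Lemma subgradient_le x g y : edom f y -> subdifferential f x g ->
  fine (f x) + dotv g (y - x) <= fine (f y).
Proof.
move=> fy [fx /(_ y)].
by rewrite -(fineK_edom (f0 x) fx) -(fineK_edom (f0 y) fy) -EFinD lee_fin.
Qed.

(** The sum [f + h] is lower semicontinuous and its domain lies in the bounded domain of [h], so the
    infimum is attained at a finite value. *)
Lemma ex_minimizer : exists x, edom h x /\
  ereal_inf (range (fun x => f x + h x)%E) = (objective x)%:E.
Proof.
have F0 x : (-oo < f x + h x)%E by have := h0 x; have := f0 x;
  case: (f x) (h x) => [a||] [b||]//= _ _; rewrite ?ltNyr.
have Fh x : edom (fun x => f x + h x)%E x -> edom h x.
  by rewrite /edom /=; have := f0 x; case: (f x) (h x) => [a||] [b||]//= _; rewrite ?ltry.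
have [||||x xmin] := @ex_argmin R n (fun x => f x + h x)%E.
- exact: F0.
- by case: hf hh => _ lf _ [_ lh _]; exact: lower_semicontinuousD.
- case: hh => -[_ [x hx]] _ _; exists x.
  by rewrite /edom /= objectiveE// ltry.
- by have [b bP] := hbnd; exists b => x /Fh; exact: bP.
have hx : edom h x.
  apply: Fh; case: hh => -[_ [y hy]] _ _; rewrite /edom /=.
  by apply: le_lt_trans (xmin y) _; rewrite objectiveE// ltry.
exists x; split => //; apply/eqP; rewrite eq_le; apply/andP; split.
  by apply: ereal_inf_lbound; exists x => //; rewrite objectiveE.
by apply: le_ereal_inf_tmp => _ [y _ <-]; rewrite -objectiveE.
Qed.

(* The three error terms (curvature, Lipschitz part, noise) are each absorbed
   by a fraction of the term [- enorm (p - x) ^+ 2 / 2] provided by the proximal step. *)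
Lemma descent_step x g s z (p := prox eta h (x - eta *: g)) :
  edom h x -> edom h z -> subdifferential f x s ->
  eta * (objective p - objective z) <=
    enorm (x - z) ^+ 2 / 2 - enorm (p - z) ^+ 2 / 2
    + (eta * dotv (g - s) (z - x) + B * (enorm (g - s) `^ alpha / sigma `^ alpha))
    + (eta * (eps / 8) + 2 * eta ^+ 2 * Mf ^+ 2).
Proof.
move=> hx hz xs; have hp : edom h p := prox_edom eta hh hbnd _.
have [gp pgp] := ex_subgrad (hdom hp).
have := prox_three_points hh hbnd heta (x - eta *: g) hz; rewrite -/p.
have pDx : enorm (p - x) <= D by have [b bP] := hbnd; apply: le_ediam bP _ _.
have d0 := enorm_ge0 (p - x).
have noise : eta * enorm (g - s) * enorm (p - x) <=
    enorm (p - x) ^+ 2 / 8 + B * (enorm (g - s) `^ alpha / sigma `^ alpha).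
  by apply: noise_term_le => //; rewrite ?enorm_ge0// d0.
have holder := holder_term_le hHf hnu heps d0.
have := subgradient_le (hdom hx) pgp; have := subgradient_le (hdom hz) xs.
have lip : dotv (gp - s) (p - x) <=
    (Lf * enorm (p - x) + Hf * enorm (p - x) `^ nu + Mf) * enorm (p - x).
  apply: le_trans (dotv_le_enorm _ _) _; apply: ler_wpM2r => //.
  exact: hsub (hdom hx) (hdom hp) xs pgp.
have cs : dotv (g - s) (x - p) <= enorm (g - s) * enorm (p - x).
  by rewrite (enormB p); exact: dotv_le_enorm.
have polar y : enorm (y - (x - eta *: g)) ^+ 2 =
    enorm (y - x) ^+ 2 + 2 * eta * dotv g (y - x) + eta ^+ 2 * dotv g g.
  have -> : y - (x - eta *: g) = (y - x) + eta *: g by rewrite opprB addrA addrAC.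
  by rewrite (sqr_enormD (y - x)) dotvZr (dotvC _ g) (sqr_enorm (eta *: g)) dotvZl dotvZr; ring.
rewrite !polar (enormB z p) (enormB z x).
have -> : dotv gp (x - p) = - dotv gp (p - x) by rewrite -dotvNr opprB.
(* The noise [g - s] enters twice: against [z - x], fixed before the sample is drawn, and against
   [x - p], which depends on the sample and is bounded by norms. *)
have -> : dotv s (z - x) = dotv g (z - x) - dotv (g - s) (z - x).
  by rewrite dotvDl dotvNl opprB subrKC.
have gsxp : dotv (gp - s) (p - x) = dotv gp (p - x) - dotv g (p - x) - dotv (g - s) (x - p).
  by rewrite -(opprB p x) dotvNr !dotvDl !dotvNl; ring.
rewrite gsxp in lip.
rewrite /objective.
move: (noise) (holder) lip cs d0; set d := enorm (p - x); set B' := B * _.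
set P2 := enorm (p - z); set X2 := enorm (x - z).
move: (dotv gp _) (dotv g (p - x)) (dotv g (z - x)) (dotv (g - s) _) (dotv (g - s) _) (dotv g g).
move: (fine _) (fine _) (fine _) (fine _) (fine _) => hz' hp' fp' fz' fx' a dp dz e2 e3 gg.
move=> {}noise {}holder {}lip {}cs {}d0 fz_ge fp_le proxle.
have c2 : eta * (2 * eta)^-1 = 2^-1 by field; rewrite gt_eqF.
have h1 : eta * (hp' - hz') <=
    (X2 ^+ 2 + 2 * eta * dz) / 2 - (d ^+ 2 + 2 * eta * dp) / 2 - P2 ^+ 2 / 2.
  by move: proxle; rewrite -(ler_pM2l heta) !mulrDr !(mulrA eta) c2; lra.
have h2 : eta * (fp' - fz') <= eta * (dp + (enorm (g - s) * d + ((Lf + Leps Hf nu eps) * d ^+ 2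
    + eps / 8 + Mf * d)) - dz + e2).
  by rewrite ler_pM2l//; lra.
(* Shares of [d ^+ 2 / 2]: the curvature takes [d ^+ 2 / 4] by the step-size bound, the term
   [eta * Mf * d] takes [d ^+ 2 / 8] and leaves [2 * eta ^+ 2 * Mf ^+ 2], and the noise takes the
   last [d ^+ 2 / 8]. *)
have h3 : 0 <= (1 - eta * (4 * (Lf + Leps Hf nu eps))) * d ^+ 2.
  by rewrite mulr_ge0 ?sqr_ge0// subr_ge0.
have h4 := sqr_ge0 (d - 4 * eta * Mf).
lra.
Qed.

Lemma spsg_iter_edom (Xi : Type) (G : 'rV[R]_n -> Xi -> 'rV[R]_n) (x0 : 'rV[R]_n)
  (s : nat -> Xi) k : edom h x0 -> edom h (spsg_iter h G x0 (fun=> eta) s k).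
Proof. by move=> hx0; case: k => //= k; exact: prox_edom. Qed.

Lemma spsg_avgE (Xi : Type) (G : 'rV[R]_n -> Xi -> 'rV[R]_n) (x0 : 'rV[R]_n)
    (s : nat -> Xi) k :
  spsg_avg h G x0 (fun=> eta) s k.+1 =
  k.+1%:R^-1 *: \sum_(t < k.+1) spsg_iter h G x0 (fun=> eta) s t.+1.
Proof.
rewrite /spsg_avg -scaler_sumr scalerA sumr_const card_ord; congr (_ *: _).
by rewrite -mulr_natr; field; rewrite nat1r pnatr_eq0 (gt_eqF heta).
Qed.

Lemma spsg_avg_edom (Xi : Type) (G : 'rV[R]_n -> Xi -> 'rV[R]_n) (x0 : 'rV[R]_n)
  (s : nat -> Xi) k : edom h x0 -> edom h (spsg_avg h G x0 (fun=> eta) s k.+1).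
Proof.
move=> hx0; rewrite spsg_avgE; case: hh => ph _ ch.
by case: (@econvex_average _ _ h (fun t => spsg_iter h G x0 (fun=> eta) s t.+1) k ph ch)
  => // t; exact: spsg_iter_edom.
Qed.

(** A pathwise bound, for every sample sequence and every selection [m] of subgradients; randomness
    enters only when [m] becomes the mean of the oracle. *)
Lemma spsg_avg_le (Xi : Type) (G : 'rV[R]_n -> Xi -> 'rV[R]_n) (m : 'rV[R]_n -> 'rV[R]_n)
    (x0 z : 'rV[R]_n) (s : nat -> Xi) (K : nat) (x := spsg_iter h G x0 (fun=> eta) s) :
  (forall x, edom f x -> subdifferential f x (m x)) ->
  edom h x0 -> edom h z -> (0 < K)%N ->
  K%:R * eta * (objective (spsg_avg h G x0 (fun=> eta) s K) - objective z) <=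
    D ^+ 2 / 2
    + \sum_(k < K) (eta * dotv (G (x k) (s k) - m (x k)) (z - x k)
        + B * (enorm (G (x k) (s k) - m (x k)) `^ alpha / sigma `^ alpha))
    + K%:R * (eta * (eps / 8) + 2 * eta ^+ 2 * Mf ^+ 2).
Proof.
move=> xm hx0 hz; case: K => // K _.
have hx t : edom h (x t) by exact: spsg_iter_edom.
have avg : K.+1%:R * objective (spsg_avg h G x0 (fun=> eta) s K.+1) <=
    \sum_(t < K.+1) objective (x t.+1).
  rewrite spsg_avgE /objective big_split mulrDr /=.
  case: hf => pf _ cf; case: hh => ph _ ch; apply: lerD.
    by case: (@econvex_average _ _ f (fun t => x t.+1) K pf cf) => // t; exact: hdom.
  by case: (@econvex_average _ _ h (fun t => x t.+1) K ph ch).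
have telescope k : eta * \sum_(t < k) (objective (x t.+1) - objective z) <=
    enorm (x 0%N - z) ^+ 2 / 2 - enorm (x k - z) ^+ 2 / 2
    + \sum_(t < k) (eta * dotv (G (x t) (s t) - m (x t)) (z - x t)
        + B * (enorm (G (x t) (s t) - m (x t)) `^ alpha / sigma `^ alpha))
    + k%:R * (eta * (eps / 8) + 2 * eta ^+ 2 * Mf ^+ 2).
  elim: k => [|k IHk]; first by rewrite !big_ord0 mulr0 mul0r; lra.
  rewrite !big_ord_recr /= mulrDr.
  have step : eta * (objective (x k.+1) - objective z) <= _ :=
    descent_step (G (x k) (s k)) (hx k) hz (xm _ (hdom (hx k))).
  by rewrite (_ : k.+1%:R = k%:R + 1) ?natr1//; move: IHk step; lra.
have x0D : enorm (x 0%N - z) ^+ 2 <= D ^+ 2.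
  have [b bP] := hbnd; rewrite ler_sqr ?nnegrE ?enorm_ge0 ?(ltW hDh)//.
  exact: (le_ediam bP).
have := telescope K.+1; rewrite sumrB sumr_const card_ord -mulr_natl.
have : eta * (K.+1%:R * objective (spsg_avg h G x0 (fun=> eta) s K.+1)) <=
  eta * \sum_(t < K.+1) objective (x t.+1) by rewrite ler_pM2l.
have := sqr_ge0 (enorm (x K.+1 - z)).
rewrite [K.+1%:R * eta]mulrC -mulrA.
move: (objective _) (objective _) => o1 o2.
lra.
Qed.

End Descent.

(** * The stochastic oracle *)

(** Tonelli's theorem applied to the positive and negative parts; it makes the mean of the oracle a
    measurable function of the state. *)
Lemma measurable_integral_section {R : realType} {d1 d2 : measure_display}
    {T : measurableType d1} {Xi : measurableType d2} (mu : probability Xi R)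
    (g : T * Xi -> R) :
  measurable_fun [set: T * Xi] g ->
  measurable_fun setT (fun x => \int[mu]_s (g (x, s))%:E)%E.
Proof.
move=> mg; pose f : T * Xi -> \bar R := EFin \o g.
have mf : measurable_fun [set: T * Xi] f by apply/measurable_EFinP.
have mfp := measurable_fun_fubini_tonelli_F (m2 := mu) _ (measurable_funepos mf) (funepos_ge0 f).
have mfn := measurable_fun_fubini_tonelli_F (m2 := mu) _ (measurable_funeneg mf) (funeneg_ge0 f).
rewrite (_ : (fun x => _) = (fubini_F mu f^\+ \- fubini_F mu f^\-)%E).
  exact: emeasurable_funB.
apply/funext => x; rewrite integralE; congr (_ - _)%E.
  by apply: eq_integral => s _; rewrite !funeposE.
by apply: eq_integral => s _; rewrite !funenegE.
Qed.

Section OracleMeasurability.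
Context {R : realType} {n : nat} {d : measure_display} {Xi : measurableType d}.
Variables (mu : probability Xi R) (G : 'rV[R]_n -> Xi -> 'rV[R]_n).
Hypothesis hG : measurable_estimator G.

Lemma estimator_coord_measurable i :
  measurable_fun [set: borelRn R n * Xi] (fun p : borelRn R n * Xi => G p.1 p.2 0 i).
Proof. exact: (measurableT_comp (coord_measurable i) hG). Qed.

Lemma fst_coord_measurable i :
  measurable_fun [set: borelRn R n * Xi] (fun p : borelRn R n * Xi => (p.1 : 'rV[R]_n) 0 i).
Proof. exact: (measurableT_comp (coord_measurable i) measurable_fst). Qed.

Lemma error_coord_measurable i :
  measurable_fun [set: borelRn R n * Xi]
    (fun p : borelRn R n * Xi => (G p.1 p.2 - mean mu (G p.1)) 0 i).
Proof.
rewrite (_ : (fun p => _) = (fun p : borelRn R n * Xi => G p.1 p.2 0 i -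
    fine (\int[mu]_s (G p.1 s 0 i)%:E))); last by apply/funext => p; rewrite !mxE unlock.
apply: measurable_funB; first exact: estimator_coord_measurable.
have mE := measurable_integral_section mu (estimator_coord_measurable i).
have mfE := measurableT_comp (fine_measurable measurableT) mE.
exact: (measurableT_comp mfE measurable_fst).
Qed.

Lemma inner_error_measurable (z : 'rV[R]_n) :
  measurable_fun [set: borelRn R n * Xi]
    (fun p : borelRn R n * Xi => dotv (G p.1 p.2 - mean mu (G p.1)) (z - p.1)).
Proof.
apply: measurable_sum => i; apply: measurable_funM; first exact: error_coord_measurable.
rewrite (_ : (fun p => _) = (fun p : borelRn R n * Xi => z 0 i - (p.1 : 'rV[R]_n) 0 i)).
  by apply: measurable_funB => //; exact: fst_coord_measurable.
by apply/funext => p; rewrite !mxE.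
Qed.

Lemma noise_measurable :
  measurable_fun [set: borelRn R n * Xi] (fun p : borelRn R n * Xi => noise mu G p.1 p.2).
Proof.
have := borel_measurable_continuous (@enorm_continuous R n).
move=> /measurableT_comp; apply; apply: measurable_fun_borelRn => i.
exact: error_coord_measurable.
Qed.

Lemma prox_step_measurable (h : 'rV[R]_n -> \bar R) (eta : R) :
  proper_lsc_convex h -> (exists B : R, forall x, edom h x -> enorm x <= B) -> 0 < eta ->
  measurable_fun [set: borelRn R n * Xi]
    (fun p : borelRn R n * Xi => prox eta h ((p.1 : 'rV[R]_n) - eta *: G p.1 p.2) : borelRn R n).
Proof.
move=> hh hbnd eta0; apply: measurable_fun_borelRn => i.
have := borel_measurable_continuous (prox_coord_continuous hh hbnd eta0 (i := i)).
move=> /measurableT_comp; apply; apply: measurable_fun_borelRn => j.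
rewrite (_ : (fun p => _) = (fun p : borelRn R n * Xi =>
    (p.1 : 'rV[R]_n) 0 j - eta * G p.1 p.2 0 j)); last by apply/funext => p; rewrite !mxE.
apply: measurable_funB; first exact: fst_coord_measurable.
by apply: measurable_funM => //; exact: estimator_coord_measurable.
Qed.

End OracleMeasurability.

(** * Moments of the oracle error *)

Section OracleMoments.
Context {R : realType} {n : nat} {d : measure_display} {Xi : measurableType d}.
Variables (mu : probability Xi R) (G : 'rV[R]_n -> Xi -> 'rV[R]_n).
Hypothesis hG : measurable_estimator G.
Variable x : 'rV[R]_n.
Hypothesis intG : forall i, mu.-integrable [set: Xi] (fun s => (G x s 0 i)%:E).

Let errorE (c : 'rV[R]_n) s : (dotv (G x s - mean mu (G x)) c)%:E =
  (\sum_(i < n) (c 0 i)%:E * ((G x s 0 i)%:E - (mean mu (G x) 0 i)%:E))%E.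
Proof.
rewrite -sumEFin; apply: eq_bigr => i _.
by rewrite -EFinB -EFinM mulrC !mxE.
Qed.

Let int_coord (c : 'rV[R]_n) i : mu.-integrable [set: Xi]
  (fun s => (c 0 i)%:E * ((G x s 0 i)%:E - (mean mu (G x) 0 i)%:E))%E.
Proof.
apply: integrableZl => //; apply: integrableB => //.
exact: finite_measure_integrable_cst.
Qed.

Lemma inner_error_integrable (c : 'rV[R]_n) :
  mu.-integrable [set: Xi] (fun s => (dotv (G x s - mean mu (G x)) c)%:E).
Proof. by under eq_fun do rewrite errorE; apply: integrable_sum. Qed.

Lemma inner_error_integral (c : 'rV[R]_n) :
  (\int[mu]_s (dotv (G x s - mean mu (G x)) c)%:E = 0)%E.
Proof.
under eq_integral do rewrite errorE.
rewrite integral_sum//; apply: big1 => i _.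
rewrite integralZl//; last first.
  by apply: integrableB => //; exact: finite_measure_integrable_cst.
rewrite integralB//; last exact: finite_measure_integrable_cst.
have finG := integrable_fin_num measurableT (intG i).
rewrite integral_cst_probability.
by rewrite /mean mxE unlock fineK// subee// mule0.
Qed.

Variables (sigma alpha : R).
Hypotheses (sigma0 : 0 < sigma) (alpha12 : 1 < alpha <= 2).

Local Notation X := (fun s => noise mu G x s `^ alpha / sigma `^ alpha).

Let mnoise : measurable_fun setT (noise mu G x).
Proof. exact: (measurable_fun_pair2 (x : borelRn R n) (noise_measurable mu hG)). Qed.

Let mpow : measurable_fun setT (fun s => noise mu G x s `^ alpha).
Proof. exact: (measurableT_comp (@measurable_powR R alpha) mnoise). Qed.

Lemma scaled_noise_measurable : measurable_fun setT X.
Proof.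
exact: measurable_funM.
Qed.

Lemma scaled_noise_ge0 s : 0 <= X s.
Proof. by rewrite divr_ge0 ?powR_ge0. Qed.

Lemma scaled_noise_integral_le1 :
  ('E_mu[fun s => (noise mu G x s `^ alpha)%R] <= (sigma `^ alpha)%:E)%E ->
  (\int[mu]_s (X s)%:E <= 1)%E.
Proof.
rewrite unlock => h; have s0 : 0 < sigma `^ alpha by exact: powR_gt0.
under eq_integral do rewrite mulrC EFinM.
rewrite ge0_integralZl_EFin//; first last.
- by rewrite invr_ge0 ltW.
- by apply/measurable_EFinP; exact: mpow.
- by move=> s _; rewrite lee_fin powR_ge0.
by rewrite lee_pdivrMl// mule1.
Qed.

(** The moment of order [alpha] controls the first one: above [sigma], the ratio to [sigma] is at
    most its power [alpha]. *)
Lemma noise_le s : noise mu G x s <= sigma * (1 + X s).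
Proof.
have [ns|/ltW sn] := leP (noise mu G x s) sigma.
  by apply: le_trans ns _; rewrite -[leLHS]mulr1 ler_pM2l// lerDl scaled_noise_ge0.
have r1 : 1 <= noise mu G x s / sigma by rewrite ler_pdivlMr// mul1r.
rewrite -powR_div ?enorm_ge0//.
have : noise mu G x s / sigma <= (noise mu G x s / sigma) `^ alpha.
  by apply: le1r_powR => //; case/andP: alpha12 => /ltW.
rewrite ler_pdivrMr// mulrC => /le_trans; apply.
by rewrite ler_pM2l// lerDr.
Qed.

Lemma inner_error_abs_integral_le (c : 'rV[R]_n) (D : R) : enorm c <= D ->
  (\int[mu]_s (X s)%:E <= 1)%E ->
  (\int[mu]_s `|(dotv (G x s - mean mu (G x)) c)%:E| <= (D * sigma * 2)%:E)%E.
Proof.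
move=> cD X1; have D0 : 0 <= D by apply: le_trans cD; exact: enorm_ge0.
have mX := scaled_noise_measurable.
apply: (@le_trans _ _ (\int[mu]_s ((D * sigma)%:E * (1 + (X s)%:E)))%E).
  apply: ge0_le_integral => //.
  - have := inner_error_integrable c => /integrableP[mY _].
    exact: measurableT_comp.
  - apply: measurable_funeM; apply: emeasurable_funD => //.
    exact/measurable_EFinP.
  move=> s _; rewrite -EFinD -EFinM lee_fin.
  apply: le_trans (norm_dotv_le _ _) _; rewrite mulrC -mulrA.
  apply: ler_pM; rewrite ?enorm_ge0//; exact: noise_le.
rewrite ge0_integralZl_EFin//; first last.
- by rewrite mulr_ge0// ltW.
- by apply: emeasurable_funD => //; exact/measurable_EFinP.
- by move=> s _; rewrite adde_ge0// lee_fin scaled_noise_ge0.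
rewrite [leRHS]EFinM lee_wpmul2l ?lee_fin ?mulr_ge0 ?(ltW sigma0)//.
rewrite ge0_integralD//; first last.
- exact/measurable_EFinP.
- by move=> s _; rewrite lee_fin scaled_noise_ge0.
rewrite (integral_cst_probability mu 1).
by rewrite -[leRHS]/((1 + 1)%:E)%E EFinD leeD2l.
Qed.

End OracleMoments.

(** * Guarantees of the method *)

(** Serves twice: for the sum over all steps in the expectation bound, and with a single term for
    the affine majorant of the Chernoff argument. *)
Lemma affine_integral_le {R : realType} {d : measure_display} {T : measurableType d}
    (P : probability T R) (K : nat) (a b e : R) (Y X : nat -> T -> R) : 0 <= e ->
  (forall k, P.-integrable setT (fun w => (Y k w)%:E)) ->
  (forall k, \int[P]_w (Y k w)%:E = 0)%E ->
  (forall k, P.-integrable setT (fun w => (X k w)%:E)) ->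
  (forall k, \int[P]_w (X k w)%:E <= 1)%E ->
  P.-integrable setT (fun w => (a + \sum_(k < K) (b * Y k w + e * X k w))%:E) /\
  (\int[P]_w (a + \sum_(k < K) (b * Y k w + e * X k w))%:E <= (a + K%:R * e)%:E)%E.
Proof.
move=> e0 iY Y0 iX X1; elim: K => [|K [IHi IHK]].
  under eq_fun do rewrite big_ord0 addr0.
  rewrite mul0r addr0 integral_cst_probability; split => //.
  exact: finite_measure_integrable_cst.
have iT : P.-integrable setT (fun w => (b * Y K w + e * X K w)%:E).
  under eq_fun do rewrite EFinD !EFinM.
  by apply: integrableD => //; apply: integrableZl.
have split_last w : (a + \sum_(k < K.+1) (b * Y k w + e * X k w))%:E =
   ((a + \sum_(k < K) (b * Y k w + e * X k w))%:E + (b * Y K w + e * X K w)%:E)%E.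
  by rewrite big_ord_recr addrA.
under eq_fun do rewrite split_last.
split; first exact: integrableD.
rewrite integralD//; under [X in (_ + X)%E]eq_integral do rewrite EFinD !EFinM.
rewrite integralD//; [|exact: integrableZl|exact: integrableZl].
rewrite !integralZl// Y0 mule0 add0e -natr1 mulrDl mul1r addrA [leRHS]EFinD.
apply: leeD => //; rewrite -[leRHS]mule1.
by apply: lee_wpmul2l => //; rewrite lee_fin.
Qed.

Section Guarantees.
Context {R : realType} {n : nat}.
Variables (f h : 'rV[R]_n -> \bar R) (Lf Hf Mf nu : R).
Hypotheses (hf : proper_lsc_convex f) (hh : proper_lsc_convex h)
  (hdom : edom h `<=` edom f)
  (hHf : 0 <= Hf) (hnu : 0 < nu < 1)
  (hsub : holder_like_subgradients f Lf Hf Mf nu)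
  (hbnd : exists B : R, forall x, edom h x -> enorm x <= B)
  (hDh : 0 < ediam (edom h)).
Context {d : measure_display} {Xi : measurableType d}.
Variables (mu : probability Xi R) (G : 'rV[R]_n -> Xi -> 'rV[R]_n) (sigma alpha : R).
Hypotheses (hG : measurable_estimator G) (hsigma : 0 < sigma) (halpha : 1 < alpha <= 2)
  (hGmean : unbiased_subgradient mu G f)
  (hGmoment : bounded_noise_moment mu G f sigma alpha).
Context {d' : measure_display} {Omega : measurableType d'}.
Variables (P : probability Omega R) (xi : nat -> Omega -> Xi) (x0 : 'rV[R]_n).
Hypotheses (hxi : iid_samples P mu xi) (hx0 : edom h x0).
Variables (eps eta : R) (K : nat).
Hypotheses (heps : 0 < eps) (heta : 0 < eta) (hK : (0 < K)%N)
  (hcurv : eta * (4 * (Lf + Leps Hf nu eps)) <= 1).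

Local Notation D := (ediam (edom h)).
Local Notation B := (noise_coef D sigma alpha eta).
Local Notation F := (fun x => (f x + h x)%E).
Local Notation avg w := (spsg_avg h G x0 (fun=> eta) (xi ^~ w) K).
Local Notation state := (borelRn R n * Xi)%type.

(** The iterates as a chain with transition [Phi], on the Borel space of states. *)
Let Z (k : nat) (w : Omega) : borelRn R n := spsg_iter h G x0 (fun=> eta) (xi ^~ w) k.
Let Phi (k : nat) (p : state) : borelRn R n :=
  prox eta h ((p.1 : 'rV[R]_n) - eta *: G p.1 p.2).

Let mPhi k : measurable_fun [set: state] (Phi k).
Proof. exact: prox_step_measurable. Qed.

Let Z0 w : Z 0%N w = x0. Proof. by []. Qed.

Let ZS k w : Z k.+1 w = Phi k (Z k w, xi k w). Proof. by []. Qed.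

Let hZ k w : edom h (Z k w).
Proof. exact: (spsg_iter_edom hh hbnd). Qed.

Let havg w : edom h (avg w).
Proof. by case: K hK => // k _; apply: spsg_avg_edom. Qed.

Let psiX (p : state) : R := noise mu G p.1 p.2 `^ alpha / sigma `^ alpha.
Let psiY (z : 'rV[R]_n) (p : state) : R := dotv (G p.1 p.2 - mean mu (G p.1)) (z - p.1).

Let mpsiX : measurable_fun [set: state] psiX.
Proof.
apply: measurable_funM => //.
exact: (measurableT_comp (@measurable_powR R alpha) (noise_measurable mu hG)).
Qed.

Let mpsiY z : measurable_fun [set: state] (psiY z).
Proof. exact: inner_error_measurable. Qed.

Let psiX0 p : 0 <= psiX p. Proof. by rewrite divr_ge0 ?powR_ge0. Qed.

Let psiX_le1 x : edom h x -> (\int[mu]_s (psiX (x, s))%:E <= 1)%E.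
Proof. by move=> hx; apply: scaled_noise_integral_le1 => //; exact/hGmoment/hdom. Qed.

Let zD x z : edom h x -> edom h z -> enorm (z - x) <= D.
Proof. by move=> hx hz; case: hbnd => b bP; exact: (le_ediam bP). Qed.

Lemma suboptimality_measurable (c : \bar R) : measurable_fun setT (fun w => F (avg w) - c)%E.
Proof.
have mavg : measurable_fun setT (fun w => avg w : borelRn R n).
  apply: measurable_fun_borelRn => i.
  case: K hK => // k _; under eq_fun do rewrite spsg_avgE// mxE summxE.
  apply: measurable_funM => //; apply: measurable_sum => t.
  exact: (measurableT_comp (coord_measurable i) (chain_measurable hxi mPhi Z0 ZS t.+1)).
have mF : measurable_fun setT (F : borelRn R n -> \bar R).
  apply: borel_measurable_lsc; case: hf hh => [[f0 _] lf _] [[h0 _] lh _].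
  exact: lower_semicontinuousD.
exact: (emeasurable_funB (measurableT_comp mF mavg) (measurable_cst c)).
Qed.

Let gap_le z w : edom h z -> K%:R * eta * (objective f h (avg w) - objective f h z) <=
    D ^+ 2 / 2 + \sum_(k < K) (eta * psiY z (Z k w, xi k w) + B * psiX (Z k w, xi k w))
    + K%:R * (eta * (eps / 8) + 2 * eta ^+ 2 * Mf ^+ 2).
Proof.
move=> hz; have subm x : edom f x -> subdifferential f x (mean mu (G x)).
  by move=> fx; exact: (hGmean fx).2.
have ex_subgrad x : edom f x -> exists g, subdifferential f x g.
  by move=> fx; exists (mean mu (G x)); exact: subm.
exact: (@spsg_avg_le _ _ f h Lf Hf Mf nu hf hh hdom hHf hnu hsub hbnd hDh ex_subgrad
  sigma alpha eps eta hsigma halpha heps heta hcurv Xi G (fun x => mean mu (G x))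
  x0 z (xi ^~ w) K subm hx0 hz hK).
Qed.

(** Division by [D * sigma] normalises the inner product so that the scaled noise dominates its
    power [alpha], as the Chernoff majorant requires. *)
Let scaled_inner_error_le x z s : edom h x -> edom h z ->
  `|psiY z (x, s) / (D * sigma)| `^ alpha <= psiX (x, s).
Proof.
move=> hx hz; rewrite /psiX -powR_div ?enorm_ge0//.
apply: ge0_ler_powR; rewrite ?nnegrE ?divr_ge0 ?enorm_ge0 ?(ltW hsigma)//.
  by case/andP: halpha; lra.
rewrite normrM normfV (gtr0_norm (mulr_gt0 hDh hsigma)) ler_pdivrMr ?mulr_gt0//.
have -> : noise mu G x s / sigma * (D * sigma) = noise mu G x s * D.
  by field; rewrite gt_eqF.
apply: le_trans (norm_dotv_le _ _) _; apply: ler_wpM2l; first exact: enorm_ge0.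
exact: zD.
Qed.

Lemma expected_suboptimality :
  (\int[P]_w (F (avg w) - ereal_inf (range F)) <=
    ((K%:R * eta)^-1 * (D ^+ 2 / 2 + K%:R * B
      + K%:R * (eta * (eps / 8) + 2 * eta ^+ 2 * Mf ^+ 2)))%:E)%E.
Proof.
have [z [hz Fz]] := ex_minimizer hf hh hdom hbnd.
have c0 : 0 < K%:R * eta by rewrite mulr_gt0 ?ltr0n.
have FE w : (F (avg w) - ereal_inf (range F) =
    (objective f h (avg w) - objective f h z)%:E)%E.
  by rewrite Fz (objectiveE hf hh hdom)// EFinB.
have ge0 w : 0 <= objective f h (avg w) - objective f h z.
  rewrite subr_ge0 -lee_fin -Fz -(objectiveE hf hh hdom)//.
  by apply: ereal_inf_lbound; exists (avg w).
have iY k : P.-integrable setT (fun w => (psiY z (Z k w, xi k w))%:E) /\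
    (\int[P]_w (psiY z (Z k w, xi k w))%:E = 0)%E.
  have absY x : edom h x -> (\int[mu]_s `|(psiY z (x, s))%:E| <= (D * sigma * 2)%:E)%E.
    move=> hx; exact: (inner_error_abs_integral_le hG (hGmean (hdom hx)).1 hsigma halpha
      (zD hx hz) (psiX_le1 hx)).
  have Y0 x : edom h x -> (\int[mu]_s (psiY z (x, s))%:E = 0)%E.
    move=> hx; rewrite -[RHS](inner_error_integral (hGmean (hdom hx)).1 (z - x)).
    exact: eq_integral.
  exact: (@chain_integral_eq0 _ _ _ _ _ _ _ P mu xi hxi Phi x0 Z (edom h) mPhi Z0 ZS hZ
    (psiY z) (D * sigma * 2) k (mpsiY z) absY Y0).
have X1 k : (\int[P]_w (psiX (Z k w, xi k w))%:E <= 1)%E.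
  have mf : measurable_fun [set: state] (EFin \o psiX) by exact/measurable_EFinP.
  have pf p : (0 <= (EFin \o psiX) p)%E by rewrite lee_fin.
  rewrite (chain_integral hxi mPhi Z0 ZS k mf pf) -(integral_cst_probability P 1).
  apply: ge0_le_integral => //.
  - by move=> w _; apply: integral_ge0 => s _; exact: pf.
  - exact: (measurableT_comp (measurable_fun_fubini_tonelli_F _ mf pf)
      (chain_measurable hxi mPhi Z0 ZS k)).
  - by move=> w _; apply: psiX_le1.
have iX k : P.-integrable setT (fun w => (psiX (Z k w, xi k w))%:E).
  apply/integrableP; split.
    by apply/measurable_EFinP; exact: (chain_comp_measurable hxi mPhi Z0 ZS).
  under eq_integral do rewrite /= ger0_norm//.
  exact: le_lt_trans (X1 k) (ltry _).
(* The deterministic part of the pathwise bound after division by [K%:R * eta]. *)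
pose a := (K%:R * eta)^-1 * (D ^+ 2 / 2 + K%:R * (eta * (eps / 8) + 2 * eta ^+ 2 * Mf ^+ 2)).
have e0 : 0 <= (K%:R * eta)^-1 * B.
  by rewrite mulr_ge0// ltW ?invr_gt0// noise_coef_gt0.
have [] := @affine_integral_le _ _ _ P K a ((K%:R * eta)^-1 * eta) ((K%:R * eta)^-1 * B)
   (fun k w => psiY z (Z k w, xi k w)) (fun k w => psiX (Z k w, xi k w)) e0
   (fun k => (iY k).1) (fun k => (iY k).2) iX X1.
move=> /integrableP[mA _] intA.
apply: (@le_trans _ _ (a + K%:R * ((K%:R * eta)^-1 * B))%:E); last first.
  by rewrite lee_fin /a; lra.
apply: le_trans intA; apply: ge0_le_integral => //.
- by move=> w _; rewrite FE lee_fin.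
- exact: suboptimality_measurable.
move=> w _; rewrite FE lee_fin -(ler_pM2l c0).
apply: le_trans (gap_le w hz) _.
have ca : K%:R * eta * a = D ^+ 2 / 2 + K%:R * (eta * (eps / 8) + 2 * eta ^+ 2 * Mf ^+ 2).
  by rewrite /a [LHS]mulrA divff ?mul1r// gt_eqF.
rewrite [X in _ <= X]mulrDr ca mulr_sumr.
set S := \sum_(k < K) _; rewrite [X in _ <= _ + X](_ : _ = S); last first.
  apply: eq_bigr => k _; rewrite [LHS]mulrDr !(mulrA (K%:R * eta)) divff ?gt_eqF// !mul1r.
  by [].
by rewrite -!addrA lerD2l addrC.
Qed.

Lemma high_probability_suboptimality (delta : R) : 0 < delta < 1 ->
  light_tailed_noise mu G f sigma alpha ->
  ((4 * alpha * D * sigma / eps) `^ (alpha / (alpha - 1)) + (1 < alpha < 2)%R%:R)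
    * (ln (2 / delta) / (alpha - 1)) <= K%:R ->
  D ^+ 2 / 2 + K%:R * eta * (eps / 4) + B * (K%:R + ln (2 / delta))
    + K%:R * (eta * (eps / 8) + 2 * eta ^+ 2 * Mf ^+ 2) <= K%:R * eta * eps ->
  ((1 - delta)%:E <= P [set w | F (avg w) - ereal_inf (range F) <= eps%:E])%E.
Proof.
move=> /andP[d0 d1] light K3 budget.
have [z [hz Fz]] := ex_minimizer hf hh hdom hbnd.
have Ds0 : 0 < D * sigma by rewrite mulr_gt0.
have r0 : 0 < eps / (4 * D * sigma) by rewrite divr_gt0// mulr_gt0// mulr_gt0.
have delta2 : 0 < 2 / delta by rewrite divr_gt0.
have lnd0 : 0 < ln (2 / delta) by apply: ln_gt0; rewrite ltr_pdivlMr// mul1r; lra.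
(* The threshold is [r = eps / (4 * D * sigma)]: a mean of the normalised inner products up to [r]
   costs [eps / 4]. *)
have [|lam [phi [a [b [lam0 b01 gain major]]]]] := chernoff_parameter (K := K%:R) halpha r0 lnd0.
  rewrite (_ : alpha / (eps / (4 * D * sigma)) = 4 * alpha * D * sigma / eps)//.
  by field; rewrite !gt_eqF.
pose psi1 (p : state) := expR (lam * (psiY z p / (D * sigma)) - phi).
pose psi2 (p : state) := expR (psiX p - 1).
have mpsi1 : measurable_fun [set: state] psi1.
  apply: measurableT_comp => //; apply: measurable_funB => //; apply: measurable_funM => //.
  exact: measurable_funM.
have mpsi2 : measurable_fun [set: state] psi2.
  by apply: measurableT_comp => //; apply: measurable_funB.
have psi2_le1 x : edom h x -> (\int[mu]_s (psi2 (x, s))%:E <= 1)%E.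
  move=> hx; have := light x (hdom hx); rewrite unlock => lx.
  rewrite (_ : (\int[mu]_s _ =
      \int[mu]_s ((expR (-1))%:E * (expR (psiX (x, s)))%:E))%E); last first.
    by apply: eq_integral => s _; rewrite -EFinM mulrC -expRD.
  have mx : measurable_fun setT (fun s => (expR (psiX (x, s)))%:E).
    have mXx := measurable_fun_pair2 (x : borelRn R n) mpsiX.
    have mex := measurableT_comp (@measurable_expR R) mXx.
    by apply/measurable_EFinP; exact: mex.
  have ex0 s : setT s -> (0 <= (expR (psiX (x, s)))%:E)%E by rewrite lee_fin expR_ge0.
  rewrite (ge0_integralZl_EFin mu measurableT ex0 mx (expR_ge0 (-1))).
  apply: (@le_trans _ _ ((expR (-1))%:E * (expR 1)%:E)%E).
    by apply: lee_wpmul2l; rewrite ?lee_fin ?expR_ge0.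
  by rewrite -EFinM -expRD addNr expR0.
have psi1_le1 x : edom h x -> (\int[mu]_s (psi1 (x, s))%:E <= 1)%E.
  move=> hx; have mpsi2x := measurable_fun_pair2 (x : borelRn R n) mpsi2.
  have mpsi1x := measurable_fun_pair2 (x : borelRn R n) mpsi1.
  have i2 : mu.-integrable setT (fun s => (psi2 (x, s))%:E).
    apply/integrableP; split; first exact/measurable_EFinP.
    under eq_integral do rewrite /= ger0_norm ?expR_ge0//.
    exact: le_lt_trans (psi2_le1 x hx) (ltry _).
  (* Integrating the majorant: the linear term vanishes and the rest is at most
     [b + (1 - b) = 1]. *)
  have [] := @affine_integral_le _ _ _ mu 1 (1 - b) (a / (D * sigma)) b
    (fun=> fun s => psiY z (x, s)) (fun=> fun s => psi2 (x, s)) (andP b01).1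
    (fun=> inner_error_integrable (hGmean (hdom hx)).1 (z - x))
    (fun=> inner_error_integral (hGmean (hdom hx)).1 (z - x)) (fun=> i2) (fun=> psi2_le1 x hx).
  move=> /integrableP[m2 _]; rewrite mul1r subrK => /(le_trans _); apply.
  apply: ge0_le_integral => //.
  - by move=> s _; rewrite lee_fin expR_ge0.
  - exact/measurable_EFinP.
  move=> s _; rewrite lee_fin big_ord_recl big_ord0 addr0.
  have := major _ _ (scaled_inner_error_le s hx hz).
  by rewrite /psi1 /psi2; lra.
pose E1 := [set w | 2 / delta <= \prod_(j < K) psi1 (Z j w, xi j w)].
pose E2 := [set w | 2 / delta <= \prod_(j < K) psi2 (Z j w, xi j w)].
have mE1 : measurable E1 by exact: (chain_prod_superlevel_measurable hxi mPhi Z0 ZS).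
have mE2 : measurable E2 by exact: (chain_prod_superlevel_measurable hxi mPhi Z0 ZS).
have PE1 : (P E1 <= ((2 / delta)^-1)%:E)%E.
  exact: (@chain_prod_markov _ _ _ _ _ _ _ P mu xi hxi Phi x0 Z (edom h) mPhi Z0 ZS hZ
    psi1 K _ delta2 mpsi1 (fun p => expR_ge0 _) psi1_le1).
have PE2 : (P E2 <= ((2 / delta)^-1)%:E)%E.
  exact: (@chain_prod_markov _ _ _ _ _ _ _ P mu xi hxi Phi x0 Z (edom h) mPhi Z0 ZS hZ
    psi2 K _ delta2 mpsi2 (fun p => expR_ge0 _) psi2_le1).
have PE : (P (E1 `|` E2) <= delta%:E)%E.
  apply: le_trans (measureU2 P mE1 mE2) _.
  apply: (@le_trans _ _ (((2 / delta)^-1)%:E + ((2 / delta)^-1)%:E)%E); first exact: leeD.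
  by rewrite -EFinD lee_fin invf_div; lra.
apply: (@le_trans _ _ (P (~` (E1 `|` E2)))).
  rewrite probability_setC; last exact: measurableU.
  rewrite EFinB; apply: leeB => //.
apply: le_measure; rewrite ?inE.
- by apply: measurableC; exact: measurableU.
- rewrite -[X in measurable X]setTI; apply: emeasurable_fun_infty_c => //.
  exact: suboptimality_measurable.
move=> w /= /not_orP[nE1 nE2].
have sumX : \sum_(j < K) psiX (Z j w, xi j w) <= K%:R + ln (2 / delta).
  move/negP: nE2; rewrite -ltNge -expR_sum -[ltRHS]lnK ?posrE// ltr_expR.
  by rewrite sumrB sumr_const card_ord ltrBlDl => /ltW.
(* Outside [E1] the sum of [lam * y - phi] is below [ln (2 / delta) <= K%:R * (lam * r - phi)]; the
   [phi] cancel, so the normalised inner products sum to at most [K%:R * r]. *)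
have sumY : \sum_(j < K) psiY z (Z j w, xi j w) <= K%:R * (eps / 4).
  move/negP: nE1; rewrite -ltNge -expR_sum -[ltRHS]lnK ?posrE// ltr_expR.
  rewrite sumrB sumr_const card_ord -mulr_sumr -mulr_suml -(mulr_natl phi) => /ltW.
  move=> /le_trans/(_ gain); rewrite mulrBr lerD2r [X in _ <= X]mulrCA ler_pM2l// ler_pdivrMr//.
  congr (_ <= _); by field; rewrite !gt_eqF.
rewrite Fz (objectiveE hf hh hdom)// -EFinB lee_fin.
have Keta0 : 0 < K%:R * eta by rewrite mulr_gt0 ?ltr0n.
rewrite -(ler_pM2l Keta0); apply: le_trans (gap_le w hz) (le_trans _ budget).
rewrite big_split -!mulr_sumr /=.
have := noise_coef_gt0 hDh hsigma halpha heta => B0.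
rewrite lerD2r -addrA lerD2l; apply: lerD.
  by rewrite [K%:R * eta]mulrC -mulrA ler_pM2l.
by rewrite ler_pM2l.
Qed.

End Guarantees.

(** * The two complexity bounds *)

Lemma Leps_ge0 {R : realType} (Hf nu eps : R) : 0 <= Leps Hf nu eps.
Proof. by rewrite mulr_ge0 ?powR_ge0. Qed.

Lemma Lambda_sq_gt0 {R : realType} (D sigma alpha eps : R) :
  0 < D -> 0 < sigma -> 1 < alpha -> 0 < eps -> 0 < Lambda_sq D sigma alpha eps.
Proof.
move=> D0 s0 a1 e0; have a10 : 0 < alpha - 1 by lra.
by rewrite /Lambda_sq; pos.
Qed.

Theorem theorem1 (R : realType) (n : nat)
  (f h : 'rV[R]_n -> \bar R)
  (hf : proper_lsc_convex f) (hh : proper_lsc_convex h)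
  (hdom : edom h `<=` edom f)
  (Lf Hf Mf nu : R) (hLf : 0 <= Lf) (hHf : 0 <= Hf) (hMf : 0 <= Mf)
  (hnu : 0 < nu < 1)
  (hsub : holder_like_subgradients f Lf Hf Mf nu)
  (hbnd : exists B : R, forall x, edom h x -> enorm x <= B)
  (hDh : 0 < ediam (edom h))
  (d : measure_display) (Xi : measurableType d) (mu : probability Xi R)
  (G : 'rV[R]_n -> Xi -> 'rV[R]_n)
  (hGmeas : measurable_estimator G)
  (sigma alpha : R) (hsigma : 0 < sigma) (halpha : 1 < alpha <= 2)
  (hGmean : unbiased_subgradient mu G f)
  (hGmoment : bounded_noise_moment mu G f sigma alpha)
  (d' : measure_display) (Omega : measurableType d')
  (P : probability Omega R) (xi : nat -> Omega -> Xi)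
  (hxi : iid_samples P mu xi)
  (x0 : 'rV[R]_n) (hx0 : edom h x0)
  (eps delta : R) (heps : 0 < eps < 1) (hdelta : 0 < delta < 1)
  (K : nat) (hK : (1 <= K)%N) :
  let F := fun x => (f x + h x)%E in
  let Fstar := ereal_inf (range F) in
  let Dh := ediam (edom h) in
  let Le := Leps Hf nu eps in
  let Lam := Lambda Dh sigma alpha eps in
  let tLam := tLambda Dh sigma alpha delta eps in
  let eta := stepsize Lf Mf Dh Le Lam K in
  let teta := stepsize Lf Mf Dh Le tLam K in
  (Num.max (Num.max (8 * Dh ^+ 2 * (Lf + Le) / eps)
                    (8 * Dh ^+ 2 * (Mf + Lam) ^+ 2 / eps ^+ 2)) 1 <= K%:R ->
   (\int[P]_w (F (spsg_avg h G x0 (fun=> eta) (xi ^~ w) K) - Fstar)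
      <= eps%:E)%E)
  /\
  (light_tailed_noise mu G f sigma alpha ->
   Num.max (Num.max (Num.max (8 * Dh ^+ 2 * (Lf + Le) / eps)
                             (32 * Dh ^+ 2 * (Mf + tLam) ^+ 2 / eps ^+ 2))
                    (((4 * alpha * Dh * sigma / eps) `^ (alpha / (alpha - 1))
                        + (1 < alpha < 2)%R%:R)
                       * (ln (2 / delta) / (alpha - 1)))) 1 <= K%:R ->
   ((1 - delta)%:E
      <= P [set w | F (spsg_avg h G x0 (fun=> teta) (xi ^~ w) K) - Fstar
                      <= eps%:E])%E).
Proof.
move=> F Fstar Dh Le Lam tLam eta teta.
case/andP: (heps) => e0 e1; case/andP: (hdelta) => d0 d1; case/andP: (halpha) => a1 a2.
have L0 : 0 < Lambda_sq Dh sigma alpha eps by exact: Lambda_sq_gt0.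
have LfLe0 : 0 <= Lf + Le by rewrite addr_ge0// Leps_ge0.
have KR0 : 0 < K%:R :> R by rewrite ltr0n.
split=> [|light]; rewrite !ge_max -!andbA.
  move=> /and3P[K1 K2 _].
  have Lam0 : 0 < Lam by rewrite sqrtr_gt0.
  have LamE : Lam ^+ 2 = Lambda_sq Dh sigma alpha eps by rewrite sqr_sqrtr// ltW.
  have [eta0 curv _ _] := stepsizeP Mf LfLe0 hDh Lam0 hK.
  (* The constant [8] is [2 / b ^+ 2] for [b = 1 / 2]. In units of [K%:R * eta * eps] the budget is
     then 1/4 for the initial distance, 1/2 for the squared terms, 1/8 for the Hoelder residual and
     at most 1/8 for the noise residual. *)
  have [||budget1 budget2] := stepsize_budget (b := 2^-1) LfLe0 hDh Lam0 hK e0 hMf _ K1.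
  - by rewrite lexx invr_ge0 ler0n.
  - by move: K2; rewrite -/Dh; set q := (Mf + Lam) ^+ 2; lra.
  have := noise_coef_le hDh hsigma halpha eta0 e0 ltr01.
  rewrite powR1 mul1r mulr1 -LamE => hB.
  apply: le_trans (expected_suboptimality hf hh hdom hHf hnu hsub hbnd hDh hGmeas hsigma
    halpha hGmean hGmoment hxi hx0 e0 eta0 hK curv) _.
  rewrite lee_fin mulrC ler_pdivrMr ?mulr_gt0//.
  have h3 : 0 <= (alpha - 1) * (K%:R * eta * eps) by rewrite mulr_ge0//; [lra|apply/ltW; pos].
  have h4 : K%:R * noise_coef Dh sigma alpha eta <=
      K%:R * (eta ^+ 2 * Lam ^+ 2 + (2 - alpha) * (eta * eps / 8)).
    by rewrite ler_pM2l.
  rewrite -/Dh -/Le -/Lam -/eta in budget1 budget2 *.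
  lra.
move=> /and4P[K1 K2 K3 _].
pose c := 1 + ln (2 / delta).
have lnd0 : 0 < ln (2 / delta) by apply: ln_gt0; rewrite ltr_pdivlMr// mul1r; lra.
have c0 : 0 < c by rewrite /c; lra.
have tL0 : 0 < tLambda_sq Dh sigma alpha delta eps by rewrite mulr_gt0// powR_gt0.
have tLam0 : 0 < tLam by rewrite sqrtr_gt0.
have tLamE : tLam ^+ 2 = tLambda_sq Dh sigma alpha delta eps by rewrite sqr_sqrtr// ltW.
have [eta0 curv _ _] := stepsizeP Mf LfLe0 hDh tLam0 hK.
(* Here [32] is [2 / b ^+ 2] for [b = 1 / 4]; the quarter saved on the squared terms pays for the
   inner products. *)
have [||budget1 budget2] := stepsize_budget (b := 4^-1) LfLe0 hDh tLam0 hK e0 hMf _ K1.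
- by rewrite invr_ge0 ler0n /=; lra.
- by move: K2; rewrite -/Dh; set q := (Mf + tLam) ^+ 2; lra.
have hB := noise_coef_le hDh hsigma halpha eta0 e0 c0.
rewrite -/(tLambda_sq Dh sigma alpha delta eps) -tLamE in hB.
have B0 := noise_coef_gt0 hDh hsigma halpha eta0.
have h3 : 0 <= (alpha - 1) * (K%:R * teta * eps) by rewrite mulr_ge0//; [lra|apply/ltW; pos].
have h4 : K%:R * (noise_coef Dh sigma alpha teta * c) <=
    K%:R * (teta ^+ 2 * tLam ^+ 2 + (2 - alpha) * (teta * eps / 8)).
  by rewrite ler_pM2l.
(* Since [K >= 1], [K%:R + ln (2 / delta)] is at most [K%:R * c], so the noise bound with factor [c]
   applies. *)
have h5 : 0 <= noise_coef Dh sigma alpha teta * ((K%:R - 1) * ln (2 / delta)).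
  have K10 : 0 <= K%:R - 1 :> R by rewrite subr_ge0 ler1n.
  exact: mulr_ge0 (ltW B0) (mulr_ge0 K10 (ltW lnd0)).
apply: (high_probability_suboptimality hf hh hdom hHf hnu hsub hbnd hDh hGmeas hsigma
    halpha hGmean hxi hx0 e0 eta0 hK curv hdelta light K3).
rewrite -/Dh -/Le -/tLam -/teta in budget1 budget2 *; rewrite /c in h4.
lra.
Qed.
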